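(* For all real $x\geqslant 1$ define $$\Delta(x):=\sum_{n\leqslant x}\tau(n)-x(\log x+2\gamma-1),\qquad \delta(x):=\sum_{n\leqslant x}\frac{\tau(n)}{n}-\Big(\tfrac12\log^2x+2\gamma\log x+\gamma^2-2\gamma_1\Big).$$ Then $\Delta(x)-x\delta(x)=\tfrac14+r(x)$, where $$|r(x)|\leqslant \frac18+\frac{0.316}{\sqrt{x}}+\frac{1}{64x}\quad\text{for all } x\geqslant 1,$$ and $$|r(x)|\leqslant \frac{\log x}{x^{1/4}}+\frac{0.236}{\sqrt{x}}+\frac{1}{64x}\quad\text{for all } x\geqslant 300.$$
   Context: $\tau(n)$ denotes the number of positive divisors of $n$. $\gamma$ is the Euler–Mascheroni constant and $\gamma_1$ is the first Stieltjes constant (so that $\zeta(s)=\frac{1}{s-1}+\gamma-\gamma_1(s-1)+O((s-1)^2)$ near $s=1$). *)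

(* Defs.v *)
From Stdlib Require Import Reals List Arith ZArith.
From Coquelicot Require Import Coquelicot.
Open Scope R_scope.

(* [n mod d] is only evaluated for [1 <= d <= n]; [tau 0 = 0] is never used. *)
Definition tau (n : nat) : nat :=
  length (List.filter (fun d => Nat.eqb (n mod d)%nat 0%nat) (List.seq 1 n)).

(* The sum of [f n] over the integers [1 <= n <= x]; [Int_part] is the floor. *)
Definition sum_upto (f : nat -> R) (x : R) : R :=
  sum_n_m f 1 (Z.to_nat (Int_part x)).

Definition euler_gamma : R :=
  real (Lim_seq (fun N : nat => sum_n_m (fun k => / INR k) 1 N - ln (INR N))).

(* First Stieltjes constant, about -0.0728. With this sign,
   zeta s = 1 / (s - 1) + euler_gamma - stieltjes_gamma1 * (s - 1) + O((s - 1)^2)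
   as s tends to 1. *)
Definition stieltjes_gamma1 : R :=
  real (Lim_seq (fun N : nat =>
    sum_n_m (fun k => ln (INR k) / INR k) 1 N - ln (INR N) ^ 2 / 2)).

Definition Delta_tau (x : R) : R :=
  sum_upto (fun n => INR (tau n)) x - x * (ln x + 2 * euler_gamma - 1).

Definition delta_tau (x : R) : R :=
  sum_upto (fun n => INR (tau n) / INR n) x
  - (1 / 2 * ln x ^ 2 + 2 * euler_gamma * ln x
     + euler_gamma ^ 2 - 2 * stieltjes_gamma1).

(* Main.v *)
Require Import Defs.
From Stdlib Require Import Reals.
From Stdlib Require Import Lra Lia ZArith.
From Coquelicot Require Import Coquelicot.
Open Scope R_scope.

(* Let u = sqrt x, N the floor of u and psi(t) = {t} - 1/2.  The hyperbola method applied to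
   sum_{n <= x} tau(n) (1 - x/n), together with Euler-Maclaurin expansions of the partial sums of
   1/k and log k / k at u, makes all main terms cancel and gives
     r(x) = -2 sum_{a <= N} (x/a) h(x/a) + 2 x q(u) - 2 u psi(u) h(u) + x h(u)^2,
   where h(t) = O(1/t^2) is the error term of the harmonic sums and q(u) = O(1/u^3) combines both
   error terms at u.  The bounds |h(t)| <= 1/(8 t^2) and |q(u)| <= 1/(36 u^3) give the first
   estimate, which implies the second one for x^(1/4) <= (9/7)^20.  For larger x, the sum over a is
   -(1/x) sum_{a <= N} a B2({x/a}) up to O(1/u).  Sampling the Fourier series of B2 at rational
   nodes reduces it to the sums of a cos(2 pi k x/a), and the Kusmin-Landau inequality on dyadic
   blocks bounds these by 25 sqrt(k) x^(3/4); the coefficients are at most 1/(4 k^2). *)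

(** * Finite sums and the hyperbola method *)

(** Neither integrals nor infinite series of functions are used. An error term such as h is an
    explicit function on each interval [n, n + 1]. Adding a correction that makes its derivative
    nonpositive turns it into a monotone function tending to 0, hence a nonnegative one, and the
    size of the correction becomes the bound. Likewise the Fourier series of B2 enters as a finite
    identity, exact at the nodes j / (2 K + 1). The two estimates of r compete. Cancellation in the
    exponential sums saves down to 19 / b with b = x^(1/4), which is no better than the trivial 1/8
    until b is about 150. The theorem allows log x / x^(1/4), that is 4 log b / b: it stays above
    1/8 with a small margin up to b slightly beyond e^5, and it is at least 20 / b once log b >= 5.
    The rational number (9/7)^20, slightly above e^5, is therefore the meeting point, and the
    constants of the exponential sum estimates only have to end below 20. *)

Fixpoint rsum (f : nat -> R) (n : nat) : R :=
  match n with
  | O => 0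
  | S p => rsum f p + f n
  end.

Lemma rsum_S f n : rsum f (S n) = rsum f n + f (S n).
Proof. reflexivity. Qed.

Lemma sum_n_m_rsum f n : sum_n_m f 1 n = rsum f n.
Proof.
induction n as [|n IH].
- rewrite sum_n_m_zero; [reflexivity | lia].
- rewrite sum_n_Sm by lia. rewrite IH. reflexivity.
Qed.

Lemma rsum_ext f g n :
  (forall k, (1 <= k <= n)%nat -> f k = g k) -> rsum f n = rsum g n.
Proof.
induction n as [|n IH]; intros H; simpl; [reflexivity|].
rewrite IH by (intros; apply H; lia). now rewrite (H (S n)) by lia.
Qed.

Lemma rsum_plus f g n : rsum (fun k => f k + g k) n = rsum f n + rsum g n.
Proof. induction n as [|n IH]; simpl; [ring | rewrite IH; ring]. Qed.

Lemma rsum_scal c f n : rsum (fun k => c * f k) n = c * rsum f n.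
Proof. induction n as [|n IH]; simpl; [ring | rewrite IH; ring]. Qed.

Lemma rsum_const c n : rsum (fun _ => c) n = INR n * c.
Proof. induction n as [|n IH]; [simpl; ring | rewrite rsum_S, IH, S_INR; ring]. Qed.

Lemma rsum_le f g n :
  (forall k, (1 <= k <= n)%nat -> f k <= g k) -> rsum f n <= rsum g n.
Proof.
induction n as [|n IH]; intros H; simpl; [lra|].
apply Rplus_le_compat; [apply IH; intros; apply H; lia | apply H; lia].
Qed.

Lemma rsum_abs f n : Rabs (rsum f n) <= rsum (fun k => Rabs (f k)) n.
Proof.
induction n as [|n IH]; simpl; [rewrite Rabs_R0; lra|].
eapply Rle_trans; [apply Rabs_triang | lra].
Qed.

Lemma rsum_abs_le f g n :
  (forall k, (1 <= k <= n)%nat -> Rabs (f k) <= g k) -> Rabs (rsum f n) <= rsum g n.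
Proof.
intros H. eapply Rle_trans; [apply rsum_abs | now apply rsum_le].
Qed.

Lemma rsum_swap (f : nat -> nat -> R) m n :
  rsum (fun i => rsum (fun j => f i j) m) n = rsum (fun j => rsum (fun i => f i j) n) m.
Proof.
induction n as [|n IH]; simpl.
- induction m as [|m IHm]; simpl; [ring | rewrite <- IHm; ring].
- rewrite IH, <- rsum_plus. reflexivity.
Qed.

Lemma rsum_INR n : rsum INR n = INR n * (INR n + 1) / 2.
Proof. induction n as [|n IH]; [simpl; field | rewrite rsum_S, IH, S_INR; field]. Qed.

Lemma length_filter_seq (p : nat -> bool) n :
  INR (length (List.filter p (List.seq 1 n))) = rsum (fun d => if p d then 1 else 0) n.
Proof.
induction n as [|n IH]; [reflexivity|].
rewrite List.seq_S, List.filter_app, List.length_app, plus_INR, IH, rsum_S.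
f_equal. simpl. now destruct (p (S n)).
Qed.

Lemma div_succ M a : (1 <= a)%nat ->
  (S M / a = M / a + (if (S M mod a =? 0)%nat then 1 else 0))%nat.
Proof.
intros Ha.
pose proof (Nat.div_mod_eq M a) as E. pose proof (Nat.mod_upper_bound M a ltac:(lia)) as U.
pose proof (Nat.div_mod_eq (S M) a) as E'. pose proof (Nat.mod_upper_bound (S M) a ltac:(lia)) as U'.
set (q := (M / a)%nat) in *. set (q' := (S M / a)%nat) in *.
set (r := (M mod a)%nat) in *. set (r' := (S M mod a)%nat) in *.
destruct (Nat.eqb_spec r' 0) as [H|H].
- assert (q < q')%nat by nia. assert (q' < q + 2)%nat by nia. lia.
- assert (q <= q')%nat by nia. assert (q' < q + 1)%nat by nia. lia.
Qed.

(** By [div_succ], passing from [M] to [S M] lengthens the row of [a] exactly when [a] divides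
    [S M], and the new entry is then [F (S M)]. This happens in [tau (S M)] rows. *)
Lemma sum_tau_divisors F M :
  rsum (fun n => INR (tau n) * F n) M
  = rsum (fun a => rsum (fun b => F (a * b)%nat) (M / a)) M.
Proof.
induction M as [|M IH]; [reflexivity|].
rewrite rsum_S, IH.
assert (E : rsum (fun a => rsum (fun b => F (a * b)%nat) (S M / a)) (S M)
  = rsum (fun a => rsum (fun b => F (a * b)%nat) (M / a)) (S M)
    + rsum (fun a => F (S M) * (if (S M mod a =? 0)%nat then 1 else 0)) (S M)).
{ rewrite <- rsum_plus. apply rsum_ext. intros a Ha.
  rewrite div_succ by lia.
  destruct (Nat.eqb_spec (S M mod a) 0) as [H|H].
  - rewrite Nat.add_1_r, rsum_S. rewrite Rmult_1_r. f_equal. f_equal.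
    rewrite <- Nat.add_1_r.
    assert (D := div_succ M a ltac:(lia)). rewrite H in D; simpl in D.
    rewrite <- D. pose proof (Nat.div_mod_eq (S M) a). lia.
  - rewrite Nat.add_0_r. ring. }
rewrite E, rsum_scal. unfold tau. rewrite length_filter_seq.
rewrite (rsum_S (fun a => rsum (fun b => F (a * b)%nat) (M / a)) M).
rewrite (Nat.div_small M (S M)) by lia. simpl (rsum _ 0). ring.
Qed.

(** Indicators turn the region under the hyperbola into a rectangle, where [rsum_swap] applies. *)
Lemma rsum_indicator f m n : (m <= n)%nat ->
  rsum (fun b => if (b <=? m)%nat then f b else 0) n = rsum f m.
Proof.
induction n as [|n IH]; intros H.
- now replace m with O by lia.
- rewrite rsum_S. destruct (Nat.leb_spec (S n) m).
  + replace m with (S n) by lia. rewrite rsum_S. f_equal. apply rsum_ext.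
    intros k Hk. destruct (Nat.leb_spec k (S n)); [reflexivity | lia].
  + rewrite IH by lia. ring.
Qed.

Lemma rsum_prefix_zero f m n : (m <= n)%nat ->
  (forall k, (m < k <= n)%nat -> f k = 0) -> rsum f n = rsum f m.
Proof.
induction n as [|n IH]; intros Hmn Hf.
- now replace m with O by lia.
- destruct (Nat.eq_dec m (S n)) as [->|]; [reflexivity|].
  rewrite rsum_S, (Hf (S n)), IH by (try lia; intros; apply Hf; lia). ring.
Qed.

(** Since [M < S N * S N], no pair with [a * b <= M] has both coordinates above [N]. By symmetry the
    strips [a <= N] and [b <= N] have equal sums; their intersection, counted twice, is the full
    square because [N * N <= M]. *)
Lemma hyperbola (G : nat -> nat -> R) M N :
  (forall a b, G a b = G b a) -> (N * N <= M < S N * S N)%nat ->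
  rsum (fun a => rsum (fun b => G a b) (M / a)) M
  = 2 * rsum (fun a => rsum (fun b => G a b) (M / a)) N
    - rsum (fun a => rsum (fun b => G a b) N) N.
Proof.
intros Gs HN.
set (I := fun a b => if (a * b <=? M)%nat then G a b else 0).
assert (HI : forall a, (1 <= a)%nat -> rsum (fun b => G a b) (M / a) = rsum (I a) M).
{ intros a Ha. rewrite <- (rsum_indicator _ (M / a) M).
  - apply rsum_ext. intros b Hb. unfold I.
    pose proof (Nat.div_mod_eq M a). pose proof (Nat.mod_upper_bound M a ltac:(lia)).
    destruct (Nat.leb_spec b (M / a)), (Nat.leb_spec (a * b) M); try reflexivity; nia.
  - apply Nat.Div0.div_le_upper_bound; nia. }
assert (Is : forall a b, I a b = I b a).
{ intros a b. unfold I. now rewrite (Nat.mul_comm b a), Gs. }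
assert (NM : (N <= M)%nat) by nia.
rewrite (rsum_ext _ (fun a => rsum (I a) M) M) by (intros; apply HI; lia).
rewrite (rsum_ext (fun a => rsum _ (M / a)) (fun a => rsum (I a) M) N) by (intros; apply HI; lia).
rewrite (rsum_ext (fun a => rsum _ N) (fun a => rsum (I a) N) N).
2:{ intros a Ha. apply rsum_ext. intros b Hb. unfold I.
    destruct (Nat.leb_spec (a * b) M); [reflexivity | nia]. }
(* Both sides run over the rows [a > N], in which only columns [b <= N] survive. *)
assert (E : rsum (fun a => rsum (I a) M) M - rsum (fun a => rsum (I a) M) N
  = rsum (fun a => rsum (I a) N) M - rsum (fun a => rsum (I a) N) N).
{ assert (D : rsum (fun a => rsum (I a) M + -1 * rsum (I a) N) M
    = rsum (fun a => rsum (I a) M + -1 * rsum (I a) N) N).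
  { apply rsum_prefix_zero; [exact NM|]. intros a Ha.
    rewrite (rsum_prefix_zero (I a) N M NM); [ring|].
    intros b Hb. unfold I. destruct (Nat.leb_spec (a * b) M); [nia | reflexivity]. }
  rewrite !rsum_plus, !rsum_scal in D. lra. }
assert (Sw : rsum (fun a => rsum (I a) N) M = rsum (fun a => rsum (I a) M) N).
{ rewrite (rsum_swap (fun a b => I a b)). apply rsum_ext. intros. apply rsum_ext. intros. apply Is. }
lra.
Qed.

(** * Error terms of the harmonic sums *)

Lemma nonincreasing_of_derive f f' a b : a <= b ->
  (forall t, a <= t <= b -> is_derive f t (f' t)) ->
  (forall t, a <= t <= b -> f' t <= 0) -> f b <= f a.
Proof.
intros Hab D N.
destruct (MVT_gen f a b f') as [c [Hc E]].
- intros t Ht. apply D. rewrite Rmin_left, Rmax_right in Ht by lra. lra.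
- intros t Ht. rewrite Rmin_left, Rmax_right in Ht by lra.
  apply derivable_continuous_pt. exists (f' t). apply is_derive_Reals, D. lra.
- rewrite Rmin_left, Rmax_right in Hc by lra. specialize (N c Hc). nra.
Qed.

Lemma nondecreasing_of_derive f f' a b : a <= b ->
  (forall t, a <= t <= b -> is_derive f t (f' t)) ->
  (forall t, a <= t <= b -> 0 <= f' t) -> f a <= f b.
Proof.
intros Hab D N.
assert (H : - f b <= - f a); [|lra].
apply (nonincreasing_of_derive (fun t => - f t) (fun t => - f' t)); auto.
- intros t Ht. apply (is_derive_opp f), D, Ht.
- intros t Ht. specialize (N t Ht). lra.
Qed.

(* The pieces [F n] on [[n, n + 1]] glue to a continuous nonincreasing function tending to 0. *)
Lemma piecewise_nonincreasing_nonneg (F F' : nat -> R -> R) (u : R) :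
  (forall n t, u <= t -> INR n <= t <= INR n + 1 -> is_derive (F n) t (F' n t)) ->
  (forall n t, u <= t -> INR n <= t <= INR n + 1 -> F' n t <= 0) ->
  (forall n, F n (INR (S n)) = F (S n) (INR (S n))) ->
  is_lim_seq (fun n => F n (INR n)) 0 ->
  forall n t, u <= t -> INR n <= t <= INR n + 1 -> 0 <= F n t.
Proof.
intros D N J L n t Hut Ht.
assert (St : forall m s, u <= s -> INR m <= s <= INR m + 1 -> F (S m) (INR (S m)) <= F m s).
{ intros m s Hs Hm. rewrite <- J, S_INR.
  apply (nonincreasing_of_derive (F m) (F' m)); [lra | |]; intros r Hr; [apply D | apply N]; lra. }
assert (Sm : forall k, F (S n + k)%nat (INR (S n + k)) <= F n t).
{ induction k as [|k IH].
  - rewrite Nat.add_0_r. now apply St.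
  - rewrite Nat.add_succ_r. eapply Rle_trans; [|apply IH].
    assert (INR (S n) <= INR (S n + k)) by (apply le_INR; lia). rewrite S_INR in H.
    apply St; lra. }
apply (is_lim_seq_incr_n _ (S n)) in L.
apply (is_lim_seq_le _ _ 0 (F n t)) with (2 := L) (3 := is_lim_seq_const (F n t)).
intros k. rewrite Nat.add_comm. apply Sm.
Qed.

(** The inequality [ln z <= z - 1] at [z = b / a] gives [a * (ln b - ln a) <= b - a <= (b - a) * ln
    a]; the last step needs [1 <= ln a], and 3 is an integer above e. *)
Lemma ln_div_nonincreasing a b : 3 <= a <= b -> ln b / b <= ln a / a.
Proof.
intros Hab.
assert (1 <= ln a).
{ rewrite <- (ln_exp 1). apply ln_le; [apply exp_pos|]. pose proof exp_le_3. lra. }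
assert (Hq : ln (b / a) <= b / a - 1).
{ rewrite <- (ln_exp (b / a - 1)). apply ln_le; [apply Rdiv_lt_0_compat; lra|].
  pose proof (exp_ineq1_le (b / a - 1)). lra. }
rewrite ln_div in Hq by lra.
assert (a * ln b <= b * ln a).
{ assert (a * (ln b - ln a) <= b - a).
  { replace (b - a) with (a * (b / a - 1)) by (field; lra). apply Rmult_le_compat_l; lra. }
  nra. }
apply Rmult_le_reg_r with (a * b); [nra|].
replace (ln b / b * (a * b)) with (a * ln b) by (field; lra).
replace (ln a / a * (a * b)) with (b * ln a) by (field; lra). lra.
Qed.

(** * Convergence to the Euler and Stieltjes constants *)

Definition harm (n : nat) : R := rsum (fun k => / INR k) n.
Definition lharm (n : nat) : R := rsum (fun k => ln (INR k) / INR k) n.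

(** Both bounds are [ln z <= z - 1], at [z = n / (n + 1)] and at [z = (n + 1) / n]. *)
Lemma inv_S_le_ln n : (1 <= n)%nat -> / INR (S n) <= ln (INR (S n)) - ln (INR n) <= / INR n.
Proof.
intros Hn. assert (1 <= INR n) by (change 1 with (INR 1); apply le_INR; lia).
rewrite S_INR, <- ln_div by lra. split.
- assert (E : ln ((INR n + 1) / INR n) = - ln (INR n / (INR n + 1))).
  { rewrite <- ln_Rinv by (apply Rdiv_lt_0_compat; lra). f_equal. field. lra. }
  rewrite E.
  assert (ln (INR n / (INR n + 1)) <= INR n / (INR n + 1) - 1).
  { rewrite <- (ln_exp (_ - 1)). apply ln_le; [apply Rdiv_lt_0_compat; lra|].
    pose proof (exp_ineq1_le (INR n / (INR n + 1) - 1)). lra. }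
  replace (/ (INR n + 1)) with (- (INR n / (INR n + 1) - 1)) by (field; lra). lra.
- assert (ln ((INR n + 1) / INR n) <= (INR n + 1) / INR n - 1).
  { rewrite <- (ln_exp (_ - 1)). apply ln_le; [apply Rdiv_lt_0_compat; lra|].
    pose proof (exp_ineq1_le ((INR n + 1) / INR n - 1)). lra. }
  replace (/ INR n) with ((INR n + 1) / INR n - 1) by (field; lra). lra.
Qed.

(** [real] and [Lim_seq] are total, so convergence has to be proved: the sequence decreases and is
    bounded below by 0. The shift by 1 keeps away from the default value of [ln] at 0. *)
Lemma is_lim_seq_gamma : is_lim_seq (fun n => harm n - ln (INR n)) euler_gamma.
Proof.
assert (X : ex_finite_lim_seq (fun n => harm (n + 1) - ln (INR (n + 1)))).
{ apply (ex_finite_lim_seq_decr _ 0).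
  - intros n. replace (S n + 1)%nat with (S (n + 1)) by lia.
    unfold harm. rewrite rsum_S.
    pose proof (inv_S_le_ln (n + 1) ltac:(lia)). lra.
  - intros n.
    assert (ln (INR (S (n + 1))) <= harm (n + 1)).
    { induction n as [|n IH].
      - replace (0 + 1)%nat with 1%nat by lia. unfold harm; simpl.
        rewrite Rinv_1, Rplus_0_l. pose proof (inv_S_le_ln 1 ltac:(lia)) as H. simpl in H.
        rewrite ln_1, Rinv_1 in H. lra.
      - replace (S n + 1)%nat with (S (n + 1)) by lia. unfold harm in *. rewrite rsum_S.
        pose proof (inv_S_le_ln (S (n + 1)) ltac:(lia)). lra. }
    pose proof (inv_S_le_ln (n + 1) ltac:(lia)).
    assert (0 < / INR (S (n + 1))) by (apply Rinv_0_lt_compat, lt_0_INR; lia). lra. }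
destruct X as [l Hl]. apply (is_lim_seq_incr_n (fun n => harm n - ln (INR n)) 1) in Hl.
unfold euler_gamma.
rewrite (Lim_seq_ext _ (fun n => harm n - ln (INR n)))
  by (intros; now rewrite sum_n_m_rsum).
rewrite (is_lim_seq_unique _ _ Hl). exact Hl.
Qed.

Lemma ln_sqr_increment n : (3 <= n)%nat ->
  ln (INR (S n)) / INR (S n) <= ln (INR (S n)) ^ 2 / 2 - ln (INR n) ^ 2 / 2 <= ln (INR n) / INR n.
Proof.
intros Hn. assert (3 <= INR n) by (replace 3 with (INR 3) by (simpl; lra); apply le_INR; lia).
rewrite S_INR.
destruct (MVT_gen (fun t => ln t ^ 2 / 2) (INR n) (INR n + 1) (fun t => ln t / t)) as [c [Hc E]].
- intros t Ht. rewrite Rmin_left in Ht by lra. auto_derive; [lra|]. field. lra.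
- intros t Ht. rewrite Rmin_left in Ht by lra.
  apply derivable_continuous_pt. exists (ln t / t). apply is_derive_Reals.
  auto_derive; [lra|]. field. lra.
- rewrite Rmin_left, Rmax_right in Hc by lra. cbv beta in E. rewrite E.
  replace (INR n + 1 - INR n) with 1 by ring. rewrite Rmult_1_r.
  split; apply ln_div_nonincreasing; lra.
Qed.

(** Monotonicity is available from index 3 on, where [ln t / t] already decreases; hence the shift
    by 3. *)
Lemma is_lim_seq_gamma1 : is_lim_seq (fun n => lharm n - ln (INR n) ^ 2 / 2) stieltjes_gamma1.
Proof.
assert (X : ex_finite_lim_seq (fun n => lharm (n + 3) - ln (INR (n + 3)) ^ 2 / 2)).
{ apply (ex_finite_lim_seq_decr _ (lharm 3 - ln (INR 4) ^ 2 / 2)).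
  - intros n. replace (S n + 3)%nat with (S (n + 3)) by lia.
    unfold lharm. rewrite rsum_S.
    pose proof (ln_sqr_increment (n + 3) ltac:(lia)). lra.
  - intros n.
    assert (lharm 3 - ln (INR 4) ^ 2 / 2 <= lharm (n + 3) - ln (INR (S (n + 3))) ^ 2 / 2).
    { induction n as [|n IH].
      - apply Rle_refl.
      - replace (S n + 3)%nat with (S (n + 3)) by lia. unfold lharm in *. rewrite (rsum_S _ (n + 3)).
        pose proof (ln_sqr_increment (S (n + 3)) ltac:(lia)). lra. }
    pose proof (ln_sqr_increment (n + 3) ltac:(lia)).
    assert (0 <= ln (INR (S (n + 3))) / INR (S (n + 3))).
    { apply Rdiv_le_0_compat; [|apply lt_0_INR; lia].
      rewrite <- ln_1. apply ln_le; [lra|]. change 1 with (INR 1); apply le_INR; lia. }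
    lra. }
destruct X as [l Hl].
apply (is_lim_seq_incr_n (fun n => lharm n - ln (INR n) ^ 2 / 2) 3) in Hl.
unfold stieltjes_gamma1.
rewrite (Lim_seq_ext _ (fun n => lharm n - ln (INR n) ^ 2 / 2))
  by (intros; now rewrite sum_n_m_rsum).
rewrite (is_lim_seq_unique _ _ Hl). exact Hl.
Qed.

Lemma is_lim_seq_inv_INR : is_lim_seq (fun n => / INR n) 0.
Proof.
apply (is_lim_seq_inv INR p_infty); [apply is_lim_seq_INR | discriminate].
Qed.

Lemma is_lim_seq_ln_div_INR : is_lim_seq (fun n => ln (INR n) / INR n) 0.
Proof.
apply (is_lim_comp_seq (fun y => ln y / y) INR p_infty).
- apply is_lim_div_ln_p.
- exists O. intros n _. discriminate.
- apply is_lim_seq_INR.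
Qed.

(** For [n] the floor of [t] this is h(t). With [n] as a separate argument it is smooth in [t]; the
    sawtooth term cancels the jump of the harmonic sum, so consecutive pieces agree at integers and
    the closed interval [n, n + 1] may be used throughout. *)
Definition herr (n : nat) (t : R) : R :=
  harm n - ln t - euler_gamma + (t - INR n - 1 / 2) / t.
Definition lerr (n : nat) (t : R) : R :=
  lharm n - ln t ^ 2 / 2 - stieltjes_gamma1 + (t - INR n - 1 / 2) * ln t / t.

Definition bern2 (v : R) : R := v ^ 2 - v + 1 / 6.
Definition bern3 (v : R) : R := v ^ 3 - 3 / 2 * v ^ 2 + 1 / 2 * v.

Lemma bern3_bound v : 0 <= v <= 1 -> - (1 / 20) <= bern3 v <= 1 / 20.
Proof.
intros Hv. unfold bern3.
pose proof (Rle_0_sqr (v - 1 / 2 - 29 / 100)) as S1.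
pose proof (Rle_0_sqr (v - 1 / 2 + 29 / 100)) as S2. unfold Rsqr in *.
(* Put [s = v - 1/2], so that [bern3 v = s^3 - s / 4], with critical points at distance 1 / (2 sqrt
   3) from 0. For [c = 29/100], close to that value, [(s - c)^2 (s + 2 c) = s^3 - 3 c^2 s + 2 c^3]
   is nearly [bern3] plus its extreme value. *)
assert (0 <= (v - 1/2 - 29/100) * (v - 1/2 - 29/100) * (v - 1/2 + 58/100))
  by (apply Rmult_le_pos; lra).
assert (0 <= (v - 1/2 + 29/100) * (v - 1/2 + 29/100) * (58/100 - (v - 1/2)))
  by (apply Rmult_le_pos; lra).
nra.
Qed.

Lemma herr_derive n t : 0 < t -> is_derive (herr n) t (- (t - INR n - 1 / 2) / t ^ 2).
Proof. intros Ht. unfold herr. auto_derive; [lra|]. field. lra. Qed.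

Lemma lerr_derive n t : 0 < t ->
  is_derive (lerr n) t (- (t - INR n - 1 / 2) * (ln t - 1) / t ^ 2).
Proof. intros Ht. unfold lerr. auto_derive; [lra|]. field. lra. Qed.

Lemma herr_jump n : herr n (INR (S n)) = herr (S n) (INR (S n)).
Proof.
unfold herr, harm. rewrite rsum_S. assert (0 < INR (S n)) by (apply lt_0_INR; lia).
rewrite S_INR in *. field. lra.
Qed.

Lemma lerr_jump n : lerr n (INR (S n)) = lerr (S n) (INR (S n)).
Proof.
unfold lerr, lharm. rewrite rsum_S. assert (0 < INR (S n)) by (apply lt_0_INR; lia).
rewrite S_INR in *. field. lra.
Qed.

Lemma herr_lim : is_lim_seq (fun n => herr n (INR n)) 0.
Proof.
apply is_lim_seq_ext with
  (fun n => (harm n - ln (INR n)) - euler_gamma + (- (1 / 2)) * / INR n).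
- intros n. unfold herr, Rdiv. ring.
- replace (Finite 0) with (Finite (euler_gamma - euler_gamma + (- (1 / 2)) * 0)) by (f_equal; ring).
  apply is_lim_seq_plus'; [apply is_lim_seq_minus'|].
  + apply is_lim_seq_gamma.
  + apply is_lim_seq_const.
  + apply is_lim_seq_mult'; [apply is_lim_seq_const | apply is_lim_seq_inv_INR].
Qed.

Lemma lerr_lim : is_lim_seq (fun n => lerr n (INR n)) 0.
Proof.
apply is_lim_seq_ext with
  (fun n => (lharm n - ln (INR n) ^ 2 / 2) - stieltjes_gamma1 + (- (1 / 2)) * (ln (INR n) / INR n)).
- intros n. unfold lerr, Rdiv. ring.
- replace (Finite 0) with
    (Finite (stieltjes_gamma1 - stieltjes_gamma1 + (- (1 / 2)) * 0)) by (f_equal; ring).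
  apply is_lim_seq_plus'; [apply is_lim_seq_minus'|].
  + apply is_lim_seq_gamma1.
  + apply is_lim_seq_const.
  + apply is_lim_seq_mult'; [apply is_lim_seq_const | apply is_lim_seq_ln_div_INR].
Qed.

Lemma is_lim_seq_0_mult a b :
  is_lim_seq a 0 -> is_lim_seq b 0 -> is_lim_seq (fun n => a n * b n) 0.
Proof.
intros A B. replace (Finite 0) with (Finite (0 * 0)) by (f_equal; ring).
now apply is_lim_seq_mult'.
Qed.

Lemma is_lim_seq_0_scal c a : is_lim_seq a 0 -> is_lim_seq (fun n => c * a n) 0.
Proof.
intros A. replace (Finite 0) with (Finite (c * 0)) by (f_equal; ring).
apply is_lim_seq_mult'; [apply is_lim_seq_const | exact A].
Qed.

Lemma is_lim_seq_0_plus a b :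
  is_lim_seq a 0 -> is_lim_seq b 0 -> is_lim_seq (fun n => a n + b n) 0.
Proof.
intros A B. replace (Finite 0) with (Finite (0 + 0)) by (f_equal; ring).
now apply is_lim_seq_plus'.
Qed.

(* The correction [p / t ^ 2 + q / t ^ 3] is chosen so that its derivative absorbs
   that of [herr]. *)
Lemma herr_corrected_sign (e : R) (p q p' q' : R -> R) :
  (forall v, is_derive p v (p' v)) -> (forall v, is_derive q v (q' v)) ->
  p 1 = p 0 -> q 1 = q 0 ->
  (forall v t, 0 <= v <= 1 -> 1 <= t ->
     - e * (v - 1 / 2) / t ^ 2 + p' v / t ^ 2 - 2 * p v / t ^ 3
     + q' v / t ^ 3 - 3 * q v / t ^ 4 <= 0) ->
  forall n t, 1 <= t -> INR n <= t <= INR n + 1 ->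
    0 <= e * herr n t + p (t - INR n) / t ^ 2 + q (t - INR n) / t ^ 3.
Proof.
intros Dp Dq Ep Eq N.
apply piecewise_nonincreasing_nonneg with
  (F := fun n t => e * herr n t + p (t - INR n) / t ^ 2 + q (t - INR n) / t ^ 3)
  (F' := fun n t => - e * (t - INR n - 1 / 2) / t ^ 2 + p' (t - INR n) / t ^ 2
     - 2 * p (t - INR n) / t ^ 3 + q' (t - INR n) / t ^ 3 - 3 * q (t - INR n) / t ^ 4).
- intros n t Ht Hn.
  pose proof (herr_derive n t ltac:(lra)) as Dh.
  specialize (Dp (t - INR n)). specialize (Dq (t - INR n)).
  auto_derive.
  + repeat split.
    * now exists (- (t - INR n - 1 / 2) / t ^ 2).
    * now exists (p' (t - INR n)).
    * nra.
    * now exists (q' (t - INR n)).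
    * assert (0 < t ^ 3) by (apply pow_lt; lra). simpl in H. lra.
    assert (E1 : Derive (fun x : R => herr n x) t = - (t - INR n - 1 / 2) / t ^ 2)
      by now apply is_derive_unique.
    assert (E2 : Derive (fun x : R => p x) (t - INR n) = p' (t - INR n))
      by now apply is_derive_unique.
    assert (E3 : Derive (fun x : R => q x) (t - INR n) = q' (t - INR n))
      by now apply is_derive_unique.
    unfold Rminus in E2, E3. rewrite E1, E2, E3. unfold Rminus.
    field. lra.
- intros n t Ht Hn. apply N; lra.
- intros n. rewrite herr_jump, S_INR.
  replace (INR n + 1 - INR n) with 1 by ring.
  replace (INR n + 1 - (INR n + 1)) with 0 by ring. now rewrite Ep, Eq.
- apply is_lim_seq_ext with (fun n => e * herr n (INR n) + p 0 * (/ INR n * / INR n)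
     + q 0 * (/ INR n * (/ INR n * / INR n))).
  + intros n. replace (INR n - INR n) with 0 by ring.
    unfold Rdiv. simpl pow. rewrite !Rmult_1_r, !Rinv_mult. reflexivity.
  + repeat apply is_lim_seq_0_plus; apply is_lim_seq_0_scal;
      repeat apply is_lim_seq_0_mult; try apply is_lim_seq_inv_INR. apply herr_lim.
Qed.

(** The corrections [(v - 1/2)^2 / 2] and [v (1 - v) / 2] are antiderivatives of [v - 1/2] and of
    its opposite, so the terms in 1 / t^2 cancel. Both lie between 0 and 1/8: the sign settles the
    term in 1 / t^3, the size is the bound. *)
Lemma herr_bound n t : 1 <= t -> INR n <= t <= INR n + 1 -> Rabs (herr n t) <= / (8 * t ^ 2).
Proof.
intros Ht Hn.
assert (T : 0 < t ^ 2) by nra.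
assert (L : 0 <= 1 * herr n t + ((t - INR n - 1 / 2) ^ 2 / 2) / t ^ 2 + 0 / t ^ 3).
{ apply (herr_corrected_sign 1 (fun v => (v - 1 / 2) ^ 2 / 2) (fun _ => 0)
    (fun v => v - 1 / 2) (fun _ => 0)); try lra.
  - intros v. auto_derive; [auto|]. field.
  - intros v. auto_derive; auto.
  - intros v s Hv Hs. assert (0 <= (v - 1/2) ^ 2 / s ^ 3).
    { apply Rdiv_le_0_compat; [apply pow2_ge_0 | apply pow_lt; lra]. }
    replace (_ + _ - _) with (- ((v - 1 / 2) ^ 2 / s ^ 3)) by (field; lra). lra. }
assert (U : 0 <= -1 * herr n t + ((t - INR n) * (1 - (t - INR n)) / 2) / t ^ 2 + 0 / t ^ 3).
{ apply (herr_corrected_sign (-1) (fun v => v * (1 - v) / 2) (fun _ => 0)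
    (fun v => 1 / 2 - v) (fun _ => 0)); try lra.
  - intros v. auto_derive; [auto|]. field.
  - intros v. auto_derive; auto.
  - intros v s Hv Hs. assert (0 <= v * (1 - v) / s ^ 3).
    { apply Rdiv_le_0_compat; [nra | apply pow_lt; lra]. }
    replace (_ + _ - _) with (- (v * (1 - v) / s ^ 3)) by (field; lra). lra. }
replace (0 / t ^ 3) with 0 in * by (field; lra).
assert (A : (t - INR n - 1 / 2) ^ 2 / 2 / t ^ 2 <= / (8 * t ^ 2)).
{ replace (/ (8 * t ^ 2)) with (1 / 8 / t ^ 2) by (field; lra).
  apply Rmult_le_compat_r; [left; now apply Rinv_0_lt_compat|].
  pose proof (pow2_ge_0 (t - INR n - 1 / 2)). clear L U. nra. }
assert (B : (t - INR n) * (1 - (t - INR n)) / 2 / t ^ 2 <= / (8 * t ^ 2)).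
{ replace (/ (8 * t ^ 2)) with (1 / 8 / t ^ 2) by (field; lra).
  apply Rmult_le_compat_r; [left; now apply Rinv_0_lt_compat|].
  pose proof (pow2_ge_0 (t - INR n - 1 / 2)). clear L U. nra. }
apply Rabs_le. lra.
Qed.

(** One order further: [bern3 / 3] has derivative [bern2] and cancels the term in 1 / t^3. The
    constant 1/60 is a third of the bound 1/20 for [bern3] and makes the remaining term in 1 / t^4
    of one sign; 1/30 is [1/60 + 1/60]. *)
Lemma herr_bern2 n t : 1 <= t -> INR n <= t <= INR n + 1 ->
  Rabs (herr n t + bern2 (t - INR n) / (2 * t ^ 2)) <= / (30 * t ^ 3).
Proof.
intros Ht Hn.
assert (T : 0 < t ^ 3) by (apply pow_lt; lra).
assert (L : 0 <= 1 * herr n t + (bern2 (t - INR n) / 2) / t ^ 2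
  + (bern3 (t - INR n) / 3 + 1 / 60) / t ^ 3).
{ apply (herr_corrected_sign 1 (fun v => bern2 v / 2) (fun v => bern3 v / 3 + 1 / 60)
    (fun v => v - 1 / 2) (fun v => bern2 v)); unfold bern2, bern3; try lra.
  - intros v. auto_derive; [auto|]. field.
  - intros v. auto_derive; [auto|]. field.
  - intros v s Hv Hs. pose proof (bern3_bound v Hv) as H3. unfold bern3 in H3.
    assert (0 <= (v ^ 3 - 3 / 2 * v ^ 2 + 1 / 2 * v + 1 / 20) / s ^ 4).
    { apply Rdiv_le_0_compat; [lra | apply pow_lt; lra]. }
    replace (_ + _ - _) with (- ((v ^ 3 - 3 / 2 * v ^ 2 + 1 / 2 * v + 1 / 20) / s ^ 4))
      by (field; lra). lra. }
assert (U : 0 <= -1 * herr n t + (- bern2 (t - INR n) / 2) / t ^ 2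
  + (- bern3 (t - INR n) / 3 + 1 / 60) / t ^ 3).
{ apply (herr_corrected_sign (-1) (fun v => - bern2 v / 2) (fun v => - bern3 v / 3 + 1 / 60)
    (fun v => - (v - 1 / 2)) (fun v => - bern2 v)); unfold bern2, bern3; try lra.
  - intros v. auto_derive; [auto|]. field.
  - intros v. auto_derive; [auto|]. field.
  - intros v s Hv Hs. pose proof (bern3_bound v Hv) as H3. unfold bern3 in H3.
    assert (0 <= (1 / 20 - (v ^ 3 - 3 / 2 * v ^ 2 + 1 / 2 * v)) / s ^ 4).
    { apply Rdiv_le_0_compat; [lra | apply pow_lt; lra]. }
    replace (_ + _ - _) with (- ((1 / 20 - (v ^ 3 - 3 / 2 * v ^ 2 + 1 / 2 * v)) / s ^ 4))
      by (field; lra). lra. }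
pose proof (bern3_bound (t - INR n) ltac:(lra)) as H3.
replace (bern2 (t - INR n) / (2 * t ^ 2)) with (bern2 (t - INR n) / 2 / t ^ 2) by (field; lra).
replace (- bern2 (t - INR n) / 2 / t ^ 2) with (- (bern2 (t - INR n) / 2 / t ^ 2)) in U
  by (field; lra).
assert (A : (bern3 (t - INR n) / 3 + 1 / 60) / t ^ 3 <= / (30 * t ^ 3)).
{ replace (/ (30 * t ^ 3)) with (1 / 30 / t ^ 3) by (field; lra).
  apply Rmult_le_compat_r; [left; now apply Rinv_0_lt_compat | lra]. }
assert (B : (- bern3 (t - INR n) / 3 + 1 / 60) / t ^ 3 <= / (30 * t ^ 3)).
{ replace (/ (30 * t ^ 3)) with (1 / 30 / t ^ 3) by (field; lra).
  apply Rmult_le_compat_r; [left; now apply Rinv_0_lt_compat | lra]. }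
apply Rabs_le. lra.
Qed.

(** * The exact formula for the remainder *)

(* Its derivative in [t] is [- psi t * ln (t / u) / t ^ 2], which vanishes at [t = u]:
   this is why it is smaller than [herr] and [lerr] by a factor [u]. *)
Definition comb (u : R) (n : nat) (t : R) : R := lerr n t + (1 - ln u) * herr n t.

(** With [L = ln t - ln u], two integrations by parts leave the derivative
    [- bern3 / 6 * (6 L - 5) / t^4]. The constant 7/3 is chosen so that the last summand has
    derivative [- 1/120 * (6 L + 5) / t^4]. This dominates, as [|bern3| / 6 <= 1/120] and
    [|6 L - 5| <= 6 L + 5] for [L >= 0]; hence the restriction to [u <= t]. *)
Lemma comb_corrected_sign (e u : R) : e = 1 \/ e = -1 -> 1 <= u ->
  forall n t, u <= t -> INR n <= t <= INR n + 1 ->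
  0 <= e * (comb u n t + bern2 (t - INR n) / 2 * (ln t - ln u) / t ^ 2
            - bern3 (t - INR n) / 6 * (1 - 2 * (ln t - ln u)) / t ^ 3)
       + 1 / 120 * (7 / 3 + 2 * (ln t - ln u)) / t ^ 3.
Proof.
intros He Hu.
apply piecewise_nonincreasing_nonneg with
  (F := fun n t => e * (comb u n t + bern2 (t - INR n) / 2 * (ln t - ln u) / t ^ 2
            - bern3 (t - INR n) / 6 * (1 - 2 * (ln t - ln u)) / t ^ 3)
       + 1 / 120 * (7 / 3 + 2 * (ln t - ln u)) / t ^ 3)
  (F' := fun n t => (- e * (bern3 (t - INR n) / 6) * (6 * (ln t - ln u) - 5)
       - 1 / 120 * (6 * (ln t - ln u) + 5)) / t ^ 4).
- intros n t Ht Hn.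
  pose proof (herr_derive n t ltac:(lra)) as Dh.
  pose proof (lerr_derive n t ltac:(lra)) as Dl.
  unfold comb, bern2, bern3. auto_derive.
  + repeat split; try lra; try nra.
    * now exists (- (t - INR n - 1 / 2) * (ln t - 1) / t ^ 2).
    * now exists (- (t - INR n - 1 / 2) / t ^ 2).
  + assert (E1 : Derive (fun x : R => herr n x) t = - (t - INR n - 1 / 2) / t ^ 2)
      by now apply is_derive_unique.
    assert (E2 : Derive (fun x : R => lerr n x) t = - (t - INR n - 1 / 2) * (ln t - 1) / t ^ 2)
      by now apply is_derive_unique.
    rewrite E1, E2. field. lra.
- intros n t Ht Hn.
  assert (HL : 0 <= ln t - ln u) by (assert (ln u <= ln t) by (apply ln_le; lra); lra).
  pose proof (bern3_bound (t - INR n) ltac:(lra)) as H3.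
  set (L := ln t - ln u) in *. set (b := bern3 (t - INR n)) in *.
  assert (P : - e * (b / 6) * (6 * L - 5) - 1 / 120 * (6 * L + 5) <= 0).
  { destruct He as [-> | ->]; nra. }
  assert (0 < / t ^ 4) by (apply Rinv_0_lt_compat, pow_lt; lra).
  unfold Rdiv at 1. nra.
- intros n. unfold comb. rewrite herr_jump, lerr_jump, S_INR.
  replace (INR n + 1 - INR n) with 1 by ring.
  replace (INR n + 1 - (INR n + 1)) with 0 by ring. unfold bern2, bern3.
  pose proof (pos_INR n). field. lra.
- apply is_lim_seq_ext with (fun n =>
    e * lerr n (INR n) + (e * (1 - ln u)) * herr n (INR n)
    + e / 12 * (ln (INR n) / INR n * / INR n)
    + (- e * ln u / 12) * (/ INR n * / INR n)
    + 1 / 60 * (ln (INR n) / INR n * (/ INR n * / INR n))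
    + (1 / 120 * (7 / 3 - 2 * ln u)) * (/ INR n * (/ INR n * / INR n))).
  + intros n. unfold comb. replace (INR n - INR n) with 0 by ring.
    unfold bern2, bern3, Rdiv. simpl pow. rewrite !Rmult_1_r, !Rinv_mult. set (w := / INR n). field.
  + repeat apply is_lim_seq_0_plus; apply is_lim_seq_0_scal;
      repeat first [apply is_lim_seq_inv_INR | apply is_lim_seq_ln_div_INR
                   | apply is_lim_seq_0_mult]; [apply lerr_lim | apply herr_lim].
Qed.

(** At [t = u] the logarithms drop out, and 1/36 is [1/120 + 7/360]. *)
Lemma comb_bound n u : 1 <= u -> INR n <= u <= INR n + 1 ->
  Rabs (comb u n u) <= / (36 * u ^ 3).
Proof.
intros Hu Hn.
pose proof (comb_corrected_sign 1 u ltac:(lra) Hu n u ltac:(lra) Hn) as L.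
pose proof (comb_corrected_sign (-1) u ltac:(lra) Hu n u ltac:(lra) Hn) as U.
pose proof (bern3_bound (u - INR n) ltac:(lra)) as H3.
assert (T : 0 < / u ^ 3) by (apply Rinv_0_lt_compat, pow_lt; lra).
assert (u <> 0) by lra.
replace (/ (36 * u ^ 3)) with (1 / 36 * / u ^ 3) by (field; lra).
replace (ln u - ln u) with 0 in * by ring. unfold Rdiv in *.
rewrite !Rmult_0_r, !Rmult_0_l, !Rplus_0_r, !Rminus_0_r in L, U.
set (b := bern3 _) in *. set (w := / u ^ 3) in *. apply Rabs_le. nra.
Qed.

Definition rfloor (x : R) : nat := Z.to_nat (Int_part x).

Lemma rfloor_spec x : 0 <= x -> INR (rfloor x) <= x < INR (rfloor x) + 1.
Proof.
intros Hx. unfold rfloor. destruct (base_Int_part x) as [H1 H2].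
assert (0 <= Int_part x)%Z.
{ assert (-1 < Int_part x)%Z by (apply lt_IZR; lra). lia. }
rewrite INR_IZR_INZ, Z2Nat.id by assumption. lra.
Qed.

Lemma div_INR_spec x M a : (1 <= a)%nat -> INR M <= x < INR M + 1 ->
  INR (M / a) <= x / INR a <= INR (M / a) + 1.
Proof.
intros Ha Hx.
assert (0 < INR a) by (apply lt_0_INR; lia).
pose proof (Nat.div_mod_eq M a) as E. pose proof (Nat.mod_upper_bound M a ltac:(lia)) as U.
assert (L1 : INR a * INR (M / a) <= INR M) by (rewrite <- mult_INR; apply le_INR; lia).
assert (L2 : INR M + 1 <= INR a * (INR (M / a) + 1)).
{ rewrite <- !S_INR, <- mult_INR. apply le_INR. nia. }
split; apply Rmult_le_reg_l with (INR a); trivial;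
  replace (INR a * (x / INR a)) with x by (field; lra); lra.
Qed.

Definition hyp_sum (x : R) (N : nat) : R :=
  rsum (fun a => x / INR a * herr (rfloor x / a) (x / INR a)) N.

Definition remainder (x : R) : R :=
  let u := sqrt x in let N := rfloor u in
  - 2 * hyp_sum x N + 2 * x * comb u N u
  - 2 * u * (u - INR N - 1 / 2) * herr N u + x * herr N u ^ 2.

Lemma rfloor_sqrt x : 0 <= x ->
  (rfloor (sqrt x) * rfloor (sqrt x) <= rfloor x
   < S (rfloor (sqrt x)) * S (rfloor (sqrt x)))%nat.
Proof.
intros Hx.
pose proof (rfloor_spec x Hx) as HM. pose proof (rfloor_spec (sqrt x) (sqrt_pos x)) as HN.
pose proof (sqrt_sqrt x Hx) as E. pose proof (sqrt_pos x). pose proof (pos_INR (rfloor (sqrt x))).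
split.
- apply Nat.lt_succ_r, INR_lt. rewrite S_INR, mult_INR. nra.
- apply INR_lt. rewrite mult_INR, !S_INR. nra.
Qed.

(** The number of terms [m] cancels against the sawtooth term inside [herr], so the identity holds
    for every [m], not only for the floor of [x / a]. *)
Lemma inner_sum x a m : 0 < x -> (1 <= a)%nat ->
  rsum (fun b => 1 - x / INR (a * b)) m
  = x / INR a - x / INR a * ln x + x * (ln (INR a) / INR a) - euler_gamma * (x / INR a)
    - 1 / 2 - x / INR a * herr m (x / INR a).
Proof.
intros Hx Ha. assert (0 < INR a) by (apply lt_0_INR; lia).
rewrite (rsum_ext _ (fun b => 1 + (- (x / INR a)) * / INR b)).
2:{ intros b Hb. rewrite mult_INR. assert (0 < INR b) by (apply lt_0_INR; lia). field. lra. }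
rewrite rsum_plus, rsum_const, rsum_scal. unfold herr. fold (harm m).
rewrite ln_div by lra. field. lra.
Qed.

Lemma rsum_product_INR x N :
  rsum (fun a => rsum (fun b => 1 - x / INR (a * b)) N) N = INR N * INR N - x * harm N ^ 2.
Proof.
rewrite (rsum_ext _ (fun a => INR N + (- x * harm N) * / INR a)).
- rewrite rsum_plus, rsum_const, rsum_scal. fold (harm N). ring.
- intros a Ha. assert (0 < INR a) by (apply lt_0_INR; lia).
  rewrite (rsum_ext _ (fun b => 1 + (- (x / INR a)) * / INR b)).
  2:{ intros b Hb. rewrite mult_INR. assert (0 < INR b) by (apply lt_0_INR; lia). field. lra. }
  rewrite rsum_plus, rsum_const, rsum_scal. fold (harm N). field. lra.
Qed.

(** The constant 1/4 comes from completing a square: the product sum gives [- N^2], the terms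
    [- 1/2] of the inner sums give [- N], and [- N^2 - N = 1/4 - (N + 1/2)^2]. With
    [N + 1/2 = u - psi], the resulting [- psi^2] is cancelled by the one in [x * harm N ^ 2]. *)
Lemma Delta_delta_remainder x : 1 <= x ->
  Delta_tau x - x * delta_tau x = 1 / 4 + remainder x.
Proof.
intros Hx. unfold Delta_tau, delta_tau, sum_upto. fold (rfloor x).
rewrite !sum_n_m_rsum. unfold remainder.
set (u := sqrt x). set (N := rfloor u).
assert (E : rsum (fun n => INR (tau n)) (rfloor x)
  - x * rsum (fun n => INR (tau n) / INR n) (rfloor x)
  = 2 * rsum (fun a => rsum (fun b => 1 - x / INR (a * b)) (rfloor x / a)) N
    - rsum (fun a => rsum (fun b => 1 - x / INR (a * b)) N) N).
{ rewrite <- (hyperbola (fun a b => 1 - x / INR (a * b)) (rfloor x) N).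
  - rewrite <- (sum_tau_divisors (fun n => 1 - x / INR n)).
    rewrite (rsum_ext (fun n => INR (tau n) * _)
      (fun n => INR (tau n) + (- x) * (INR (tau n) / INR n))) by (intros; unfold Rdiv; ring).
    rewrite rsum_plus, rsum_scal. ring.
  - intros a b. now rewrite Nat.mul_comm.
  - apply rfloor_sqrt. lra. }
rewrite rsum_product_INR in E.
rewrite (rsum_ext (fun a => rsum _ (rfloor x / a)) (fun a =>
  (x * (1 - ln x - euler_gamma)) * / INR a + x * (ln (INR a) / INR a) + - (1 / 2)
  + (-1) * (x / INR a * herr (rfloor x / a) (x / INR a))) N) in E.
2:{ intros a Ha. rewrite inner_sum by (lra || lia). unfold Rdiv. ring. }
rewrite !rsum_plus, !rsum_scal, rsum_const in E. fold (harm N) (lharm N) (hyp_sum x N) in E.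
assert (Hu : 1 <= u) by (rewrite <- sqrt_1; apply sqrt_le_1; lra).
assert (Eu : x = u * u) by (symmetry; apply sqrt_sqrt; lra).
assert (El : ln x = 2 * ln u) by (rewrite Eu, ln_mult by lra; ring).
assert (Eh : harm N = herr N u + ln u + euler_gamma - (u - INR N - 1 / 2) / u)
  by (unfold herr; ring).
assert (EL : lharm N = lerr N u + ln u ^ 2 / 2 + stieltjes_gamma1 - (u - INR N - 1 / 2) * ln u / u)
  by (unfold lerr; ring).
unfold comb.
set (H := hyp_sum x N) in *. set (h := herr N u) in *. set (l := lerr N u) in *.
set (A := rsum (fun n => INR (tau n)) _) in *. set (B := rsum (fun n => INR (tau n) / INR n) _) in *.
replace (A - x * (ln x + 2 * euler_gamma - 1) - x * (B - (1 / 2 * ln x ^ 2 + 2 * euler_gamma * ln x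
  + euler_gamma ^ 2 - 2 * stieltjes_gamma1))) with
  ((A - x * B) - x * (ln x + 2 * euler_gamma - 1) + x * (1 / 2 * ln x ^ 2 + 2 * euler_gamma * ln x
  + euler_gamma ^ 2 - 2 * stieltjes_gamma1)) by ring.
rewrite E, Eh, EL, El. clearbody H h l A B. rewrite Eu. field. lra.
Qed.

(** The three terms at [u] contribute [2 / 36], [2 * (1/2) * (1/8)] and [(1/8)^2], using
    [|psi| <= 1/2]. *)
Lemma remainder_hyp_sum x : 1 <= x ->
  Rabs (remainder x + 2 * hyp_sum x (rfloor (sqrt x)))
  <= (1 / 18 + 1 / 8) / sqrt x + 1 / (64 * x).
Proof.
intros Hx. unfold remainder.
remember (sqrt x) as u eqn:Du. set (N := rfloor u).
assert (Hu : 1 <= u) by (rewrite Du, <- sqrt_1; apply sqrt_le_1; lra).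
assert (Eu : x = u * u) by (rewrite Du; symmetry; apply sqrt_sqrt; lra).
pose proof (rfloor_spec u ltac:(lra)) as HN. fold N in HN.
pose proof (comb_bound N u Hu ltac:(lra)) as Bc.
pose proof (herr_bound N u Hu ltac:(lra)) as Bh.
replace (_ + 2 * hyp_sum x N) with
  (2 * x * comb u N u - 2 * u * (u - INR N - 1 / 2) * herr N u + x * herr N u ^ 2) by ring.
assert (T1 : Rabs (2 * x * comb u N u) <= 1 / 18 / u).
{ rewrite Rabs_mult, (Rabs_right (2 * x)) by lra.
  replace (1 / 18 / u) with (2 * x * / (36 * u ^ 3)) by (rewrite Eu; field; lra).
  apply Rmult_le_compat_l; lra. }
assert (T2 : Rabs (2 * u * (u - INR N - 1 / 2) * herr N u) <= 1 / 8 / u).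
{ rewrite Rabs_mult, Rabs_mult, (Rabs_right (2 * u)) by lra.
  assert (Rabs (u - INR N - 1 / 2) <= 1 / 2) by (apply Rabs_le; lra).
  replace (1 / 8 / u) with (2 * u * (1 / 2) * / (8 * u ^ 2)) by (field; lra).
  pose proof (Rabs_pos (u - INR N - 1 / 2)).
  apply Rmult_le_compat; try apply Rabs_pos; nra. }
assert (T3 : Rabs (x * herr N u ^ 2) <= 1 / (64 * x)).
{ rewrite Rabs_mult, (Rabs_right x) by lra. rewrite <- RPow_abs.
  replace (1 / (64 * x)) with (x * (/ (8 * u ^ 2)) ^ 2) by (rewrite Eu; field; lra).
  apply Rmult_le_compat_l; [lra|]. apply pow_incr. split; [apply Rabs_pos | exact Bh]. }
replace ((1 / 18 + 1 / 8) / u) with (1 / 18 / u + 1 / 8 / u) by (field; lra).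
set (A1 := 2 * x * comb u N u) in *.
set (A2 := 2 * u * (u - INR N - 1 / 2) * herr N u) in *.
eapply Rle_trans; [apply Rabs_triang|].
eapply Rle_trans; [apply Rplus_le_compat_r, Rabs_triang|]. rewrite Rabs_Ropp. lra.
Qed.

Lemma quotient_spec x a : 1 <= x -> (1 <= a <= rfloor (sqrt x))%nat ->
  0 < INR a /\ 1 <= x / INR a /\
  INR (rfloor x / a) <= x / INR a <= INR (rfloor x / a) + 1.
Proof.
intros Hx Ha.
assert (0 < INR a) by (apply lt_0_INR; lia).
pose proof (rfloor_spec (sqrt x) (sqrt_pos x)).
assert (INR a <= INR (rfloor (sqrt x))) by (apply le_INR; lia).
assert (1 <= sqrt x) by (rewrite <- sqrt_1; apply sqrt_le_1; lra).
assert (sqrt x * sqrt x = x) by (apply sqrt_sqrt; lra).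
pose proof (rfloor_spec x ltac:(lra)).
split; [assumption|split].
- apply Rmult_le_reg_l with (INR a); trivial.
  replace (INR a * (x / INR a)) with x by (field; lra). nra.
- apply div_INR_spec; [lia | lra].
Qed.

(** The term of [a] is at most [a / (8 x)], and these add up to at most [u (u + 1) / (16 x)]. This
    is where the main term 1/8 of the first estimate comes from. *)
Lemma hyp_sum_bound x : 1 <= x ->
  Rabs (2 * hyp_sum x (rfloor (sqrt x))) <= 1 / 8 + 1 / 8 / sqrt x.
Proof.
intros Hx.
remember (sqrt x) as u eqn:Du. set (N := rfloor u).
assert (Hu : 1 <= u) by (rewrite Du, <- sqrt_1; apply sqrt_le_1; lra).
assert (Eu : x = u * u) by (rewrite Du; symmetry; apply sqrt_sqrt; lra).
pose proof (rfloor_spec u ltac:(lra)) as HN. fold N in HN. pose proof (pos_INR N).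
assert (Rabs (hyp_sum x N) <= rsum (fun a => / (8 * x) * INR a) N).
{ apply rsum_abs_le. intros a Ha.
  destruct (quotient_spec x a Hx ltac:(rewrite <- Du; exact Ha)) as (Pa & Q1 & Q2).
  rewrite Rabs_mult, (Rabs_right (x / INR a)) by lra.
  pose proof (herr_bound _ _ Q1 Q2).
  replace (/ (8 * x) * INR a) with (x / INR a * / (8 * (x / INR a) ^ 2)) by (field; lra).
  apply Rmult_le_compat_l; lra. }
rewrite rsum_scal, rsum_INR in H0.
rewrite Rabs_mult, (Rabs_right 2) by lra.
apply Rle_trans with (2 * (/ (8 * x) * (u * (u + 1) / 2))).
- apply Rmult_le_compat_l; [lra|]. eapply Rle_trans; [exact H0|].
  apply Rmult_le_compat_l; [left; apply Rinv_0_lt_compat; lra | nra].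
- right. rewrite Eu. field. lra.
Qed.

Lemma remainder_bound x : 1 <= x ->
  Rabs (remainder x) <= 1 / 8 + (11 / 36) / sqrt x + 1 / (64 * x).
Proof.
intros Hx.
pose proof (remainder_hyp_sum x Hx) as H1. pose proof (hyp_sum_bound x Hx) as H2.
set (S := 2 * hyp_sum x (rfloor (sqrt x))) in *.
replace (remainder x) with ((remainder x + S) + - S) by ring.
eapply Rle_trans; [apply Rabs_triang|]. rewrite Rabs_Ropp.
assert (0 < sqrt x) by (apply sqrt_lt_R0; lra).
replace (11 / 36 / sqrt x) with ((1 / 18 + 1 / 8) / sqrt x + 1 / 8 / sqrt x) by (field; lra).
lra.
Qed.

(** * Passage to the second Bernoulli polynomial *)

Definition bern2_sum (x : R) (N : nat) : R :=
  rsum (fun a => INR a * bern2 (x / INR a - INR (rfloor x / a))) N.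

(** Each of the at most [u] terms has error at most [1 / (30 (x / a)^2)], and [x / a >= u]. *)
Lemma hyp_sum_bern2_sum x : 1 <= x ->
  Rabs (hyp_sum x (rfloor (sqrt x)) + bern2_sum x (rfloor (sqrt x)) / (2 * x))
  <= 1 / 30 / sqrt x.
Proof.
intros Hx.
remember (sqrt x) as u eqn:Du. set (N := rfloor u).
assert (Hu : 1 <= u) by (rewrite Du, <- sqrt_1; apply sqrt_le_1; lra).
assert (Eu : x = u * u) by (rewrite Du; symmetry; apply sqrt_sqrt; lra).
pose proof (rfloor_spec u ltac:(lra)) as HN. fold N in HN. pose proof (pos_INR N).
replace (bern2_sum x N / (2 * x)) with (/ (2 * x) * bern2_sum x N) by (field; lra).
unfold hyp_sum, bern2_sum. rewrite <- rsum_scal, <- rsum_plus.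
eapply Rle_trans; [apply (rsum_abs_le _ (fun a => / (30 * u ^ 2)))|].
- intros a Ha.
  destruct (quotient_spec x a Hx ltac:(rewrite <- Du; exact Ha)) as (Pa & Q1 & Q2).
  assert (INR a <= INR N) by (apply le_INR; lia).
  pose proof (herr_bern2 _ _ Q1 Q2) as B.
  set (h := herr _ _) in *. set (b := bern2 _) in *.
  replace (_ + _) with (x / INR a * (h + b / (2 * (x / INR a) ^ 2))) by (field; lra).
  rewrite Rabs_mult, (Rabs_right (x / INR a)) by lra.
  apply Rle_trans with (x / INR a * / (30 * (x / INR a) ^ 3)).
  + apply Rmult_le_compat_l; lra.
  + replace (_ * _) with (/ (30 * (x / INR a) ^ 2)) by (field; lra).
    apply Rinv_le_contravar; [nra|]. apply Rmult_le_compat_l; [lra|].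
    apply pow_incr. split; [lra|]. apply Rmult_le_reg_l with (INR a); trivial.
    replace (INR a * (x / INR a)) with x by (field; lra). nra.
- rewrite rsum_const. replace (1 / 30 / u) with (u * / (30 * u ^ 2)) by (field; lra).
  apply Rmult_le_compat_r; [left; apply Rinv_0_lt_compat; nra | lra].
Qed.

Lemma remainder_bern2_sum x : 1 <= x ->
  Rabs (remainder x) <= Rabs (bern2_sum x (rfloor (sqrt x))) / x
    + (1 / 4) / sqrt x + 1 / (64 * x).
Proof.
intros Hx.
pose proof (remainder_hyp_sum x Hx) as H1. pose proof (hyp_sum_bern2_sum x Hx) as H2.
set (S := hyp_sum x (rfloor (sqrt x))) in *. set (b := bern2_sum _ _) in *.
assert (0 < sqrt x) by (apply sqrt_lt_R0; lra).
replace (remainder x) with ((remainder x + 2 * S) + (-2 * (S + b / (2 * x)) + b / x))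
  by (field; lra).
eapply Rle_trans; [apply Rabs_triang|].
eapply Rle_trans; [apply Rplus_le_compat_l, Rabs_triang|].
rewrite Rabs_mult, (Rabs_left (-2)), Rabs_div, (Rabs_right x) by lra.
assert ((1 / 18 + 1 / 8) / sqrt x + 2 * (1 / 30 / sqrt x) <= (1 / 4) / sqrt x).
{ replace (_ + _) with ((89 / 360) / sqrt x) by (field; lra).
  apply Rmult_le_compat_r; [left; now apply Rinv_0_lt_compat | lra]. }
lra.
Qed.

(** * The Kusmin-Landau inequality *)

Lemma cot_le_inv t : 0 < t < PI -> cos t / sin t <= / t.
Proof.
intros Ht.
assert (0 < sin t) by (apply sin_gt_0; lra).
assert (M : sin 0 - 0 * cos 0 <= sin t - t * cos t).
{ apply (nondecreasing_of_derive (fun s => sin s - s * cos s) (fun s => s * sin s)); [lra| |].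
  - intros s Hs. auto_derive; [auto|]. ring.
  - intros s Hs. assert (0 <= sin s) by (apply sin_ge_0; lra). nra. }
rewrite sin_0 in M.
apply Rmult_le_reg_r with (t * sin t); [nra|].
replace (cos t / sin t * (t * sin t)) with (t * cos t) by (field; lra).
replace (/ t * (t * sin t)) with (sin t) by (field; lra). lra.
Qed.

(** The reflection of [t] to [PI - t] changes the sign of the cotangent, so [cot_le_inv] serves at
    both ends. *)
Lemma cot_abs_le d t : 0 < d -> d <= t <= PI - d -> Rabs (cos t / sin t) <= / d.
Proof.
intros Hd Ht.
pose proof (cot_le_inv t ltac:(lra)) as H1. pose proof (cot_le_inv (PI - t) ltac:(lra)) as H2.
rewrite sin_minus, cos_minus, sin_PI, cos_PI in H2.
replace ((-1 * cos t + 0 * sin t) / (0 * cos t - -1 * sin t)) with (- (cos t / sin t)) in H2.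
2:{ assert (0 < sin t) by (apply sin_gt_0; lra). field. lra. }
assert (/ t <= / d) by (apply Rinv_le_contravar; lra).
assert (/ (PI - t) <= / d) by (apply Rinv_le_contravar; lra).
apply Rabs_le. lra.
Qed.

(** After clearing denominators this is [0 <= sin (b - a)]. *)
Lemma cot_nonincreasing a b : 0 < a -> a <= b -> b < PI -> cos b / sin b <= cos a / sin a.
Proof.
intros Ha Hab Hb.
assert (0 < sin a) by (apply sin_gt_0; lra). assert (0 < sin b) by (apply sin_gt_0; lra).
assert (0 <= sin (b - a)) by (apply sin_ge_0; lra). rewrite sin_minus in H1.
apply Rmult_le_reg_r with (sin a * sin b); [nra|].
replace (cos b / sin b * (sin a * sin b)) with (cos b * sin a) by (field; lra).
replace (cos a / sin a * (sin a * sin b)) with (sin b * cos a) by (field; lra). lra.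
Qed.

Lemma cos_sin_shift_IZR y (m : Z) :
  cos (y - 2 * PI * IZR m) = cos y /\ sin (y - 2 * PI * IZR m) = sin y.
Proof.
assert (P : forall (n : nat) z, cos (z - 2 * PI * INR n) = cos z /\ sin (z - 2 * PI * INR n) = sin z).
{ intros n z. split.
  - rewrite <- (cos_period (z - 2 * PI * INR n) n). f_equal. ring.
  - rewrite <- (sin_period (z - 2 * PI * INR n) n). f_equal. ring. }
destruct (Z_le_gt_dec 0 m) as [H|H].
- replace (IZR m) with (INR (Z.to_nat m)) by (rewrite INR_IZR_INZ, Z2Nat.id by lia; reflexivity).
  apply P.
- assert (E : IZR m = - INR (Z.to_nat (- m))).
  { rewrite INR_IZR_INZ, Z2Nat.id, opp_IZR by lia. ring. }
  rewrite E. destruct (P (Z.to_nat (- m)) (y - 2 * PI * - INR (Z.to_nat (- m)))) as [P1 P2].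
  rewrite <- P1, <- P2. split; f_equal; ring.
Qed.

Section KusminLandau.

(** [delta] is the distance to an integer below which terms are bounded trivially; [lambda] is the
    least decrease between consecutive values of [g]. *)
Variables delta lambda : R.
Hypothesis delta_range : 0 < delta < 1 / 2.
Hypothesis lambda_pos : 0 < lambda.

Definition cot_max : R := / (PI * delta).
(** The price of one unit interval: each of the two zones of width [delta] holds at most
    [delta / lambda + 1] terms, and half the variation of [cutcot] counts, which is at most
    [4 * cot_max] including the jumps at the zone edges. *)
Definition cell_cost : R := 2 * delta / lambda + 2 + 2 * cot_max.

Definition cutcot (f : R) : R :=
  if Rlt_dec f delta then 0 else if Rlt_dec (1 - delta) f then 0
  else cos (PI * f) / sin (PI * f).

Definition bad (f : R) : R :=
  if Rlt_dec f delta then 1 else if Rlt_dec (1 - delta) f then 1 else 0.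

(** The cost accumulated on [0, f] inside one cell: trivially bounded terms at rate [1 / lambda],
    plus half the variation of [cutcot]. The extra 1 in the upper zone pays for a term there whose
    successor has already left it. *)
Definition pot (f : R) : R :=
  if Rlt_dec f delta then f / lambda
  else if Rlt_dec (1 - delta) f then delta / lambda + 1 + (f - (1 - delta)) / lambda + 2 * cot_max
  else delta / lambda + cot_max - cos (PI * f) / sin (PI * f) / 2.

Lemma cot_max_pos : 0 < cot_max.
Proof. apply Rinv_0_lt_compat. pose proof PI_RGT_0. nra. Qed.

Lemma cell_cost_pos : 0 < cell_cost.
Proof.
pose proof cot_max_pos. assert (0 < delta / lambda) by (apply Rdiv_lt_0_compat; lra).
unfold cell_cost. replace (2 * delta / lambda) with (2 * (delta / lambda)) by (field; lra). lra.
Qed.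

Lemma cot_le_cot_max f : delta <= f <= 1 - delta -> Rabs (cos (PI * f) / sin (PI * f)) <= cot_max.
Proof. intros Hf. pose proof PI_RGT_0. apply cot_abs_le; nra. Qed.

Lemma pot_lower f : 0 <= f < 1 -> bad f + Rabs (cutcot f) / 2 <= pot f + 1.
Proof.
intros Hf. pose proof cot_max_pos as HW. unfold bad, cutcot, pot.
assert (0 < / lambda) by (now apply Rinv_0_lt_compat).
destruct (Rlt_dec f delta); [|destruct (Rlt_dec (1 - delta) f)].
- rewrite Rabs_R0. unfold Rdiv. nra.
- rewrite Rabs_R0. unfold Rdiv. nra.
- pose proof (cot_le_cot_max f ltac:(lra)) as H1. set (k := _ / sin _) in *.
  assert (0 <= delta / lambda) by (apply Rdiv_le_0_compat; lra).
  revert H1. unfold Rabs; destruct (Rcase_abs k); lra.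
Qed.

Lemma pot_upper f : 0 <= f < 1 -> pot f + Rabs (cutcot f) / 2 <= cell_cost - 1.
Proof.
intros Hf. pose proof cot_max_pos as HW. unfold cutcot, pot, cell_cost.
assert (0 < / lambda) by (now apply Rinv_0_lt_compat).
destruct (Rlt_dec f delta); [|destruct (Rlt_dec (1 - delta) f)].
- rewrite Rabs_R0. unfold Rdiv. nra.
- rewrite Rabs_R0. unfold Rdiv. nra.
- pose proof (cot_le_cot_max f ltac:(lra)) as H1. set (k := _ / sin _) in *.
  assert (0 <= delta / lambda) by (apply Rdiv_le_0_compat; lra).
  replace (2 * delta / lambda) with (2 * (delta / lambda)) by (field; lra).
  revert H1. unfold Rabs; destruct (Rcase_abs k); lra.
Qed.

Lemma pot_same_cell f f' : 0 <= f' -> f' <= f - lambda -> f < 1 ->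
  bad f + Rabs (cutcot f - cutcot f') / 2 <= pot f - pot f'.
Proof.
intros H0 Hs H1. pose proof cot_max_pos as HW. pose proof PI_RGT_0 as HP.
pose proof (cot_le_cot_max f) as Cf. pose proof (cot_le_cot_max f') as Cf'.
assert (D : 0 < / lambda) by (now apply Rinv_0_lt_compat).
assert (St : 1 <= (f - f') / lambda).
{ apply Rmult_le_reg_r with lambda; trivial.
  replace ((f - f') / lambda * lambda) with (f - f') by (field; lra). lra. }
unfold bad, cutcot, pot.
destruct (Rlt_dec f delta); [|destruct (Rlt_dec (1 - delta) f)];
  (destruct (Rlt_dec f' delta); [|destruct (Rlt_dec (1 - delta) f')]); try lra.
- rewrite Rminus_0_r, Rabs_R0. unfold Rdiv in *. lra.
- rewrite Rminus_0_r, Rabs_R0. unfold Rdiv in *. nra.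
- rewrite Rminus_0_r, Rabs_R0. unfold Rdiv in *. lra.
- specialize (Cf' ltac:(lra)). set (k := cos (PI * f') / sin (PI * f')) in *.
  rewrite Rminus_0_l, Rabs_Ropp.
  assert (0 <= (f - (1 - delta)) / lambda) by (apply Rdiv_le_0_compat; lra).
  revert Cf'. unfold Rabs; destruct (Rcase_abs k); lra.
- specialize (Cf ltac:(lra)). set (k := cos (PI * f) / sin (PI * f)) in *. rewrite Rminus_0_r.
  assert (f' / lambda <= delta / lambda) by (apply Rmult_le_compat_r; lra).
  revert Cf. unfold Rabs; destruct (Rcase_abs k); lra.
- assert (M : cos (PI * f) / sin (PI * f) <= cos (PI * f') / sin (PI * f'))
    by (apply cot_nonincreasing; nra).
  rewrite Rabs_minus_sym, Rabs_right by lra. lra.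
Qed.

(** When an integer is crossed, the two values of [cutcot] are paid for separately: the unit spent
    in [pot_lower] is the one reserved in [pot_upper]. Otherwise both points lie in the same
    cell. *)
Lemma pot_step (m m' : Z) f f' : 0 <= f < 1 -> 0 <= f' < 1 ->
  IZR m' + f' <= IZR m + f - lambda ->
  bad f + Rabs (cutcot f - cutcot f') / 2 <= (IZR m * cell_cost + pot f) - (IZR m' * cell_cost + pot f').
Proof.
intros Hf Hf' Hs.
destruct (Z_lt_ge_dec m' m) as [H|H].
- pose proof (pot_lower f Hf). pose proof (pot_upper f' Hf'). pose proof cell_cost_pos.
  assert (IZR m' + 1 <= IZR m) by (rewrite <- (plus_IZR m' 1); apply IZR_le; lia).
  assert (Rabs (cutcot f - cutcot f') <= Rabs (cutcot f) + Rabs (cutcot f')).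
  { unfold Rminus. rewrite <- (Rabs_Ropp (cutcot f')). apply Rabs_triang. }
  nra.
- assert (m <= m')%Z by lia.
  assert (m' < m + 1)%Z by (apply lt_IZR; rewrite plus_IZR; lra).
  replace m' with m in * by lia.
  pose proof (pot_same_cell f f' ltac:(lra) ltac:(lra) ltac:(lra)). lra.
Qed.

(** With [th = PI * f], this is the real part of the geometric identity [1 / (1 - exp(-2 i th)) =
    1/2 - (i/2) cot th]. Where [cutcot] is cut to 0, the mean of two cosines remains, at most 1. *)
Lemma cos_telescope_step y (m : Z) f : 0 <= f < 1 ->
  Rabs (cos y - (cos y - cos (y - 2 * PI * (IZR m + f))) / 2
        - cutcot f * (sin y - sin (y - 2 * PI * (IZR m + f))) / 2) <= bad f.
Proof.
intros Hf.
replace (y - 2 * PI * (IZR m + f)) with ((y - 2 * PI * f) - 2 * PI * IZR m) by ring.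
destruct (cos_sin_shift_IZR (y - 2 * PI * f) m) as [-> ->].
pose proof (COS_bound y). pose proof (COS_bound (y - 2 * PI * f)).
unfold cutcot, bad.
destruct (Rlt_dec f delta); [|destruct (Rlt_dec (1 - delta) f)]; [apply Rabs_le; lra..|].
assert (Sp : 0 < sin (PI * f)) by (pose proof PI_RGT_0; apply sin_gt_0; nra).
right. replace (2 * PI * f) with (2 * (PI * f)) by ring.
rewrite cos_minus, sin_minus, cos_2a_sin, sin_2a.
set (s := sin (PI * f)) in *. set (k := cos (PI * f)).
assert (E : s * s + k * k = 1).
{ pose proof (sin2_cos2 (PI * f)) as Q. unfold Rsqr in Q. exact Q. }
match goal with |- Rabs ?e = 0 => replace e with 0 end; [apply Rabs_R0|].
field_simplify_eq; [|lra].
replace (k ^ 2) with (1 - s ^ 2) by (rewrite <- E; ring). ring.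
Qed.

(* Terms with [g i] close to an integer are bounded trivially.  The others are, up to the factor
   [cutcot], differences of consecutive values of [cos] and [sin], and [cutcot (frac g)] has bounded
   variation because [g] decreases.  Both costs are charged to the potential
   [IZR (Int_part g) * cell_cost + pot (frac_part g)]. *)
Lemma kusmin_landau (F g : nat -> R) (n : nat) :
  (forall i, (1 <= i <= n)%nat -> F (S i) = F i - 2 * PI * g i) ->
  (forall i, (1 <= i <= n)%nat -> g (S i) <= g i - lambda) ->
  Rabs (rsum (fun i => cos (F i)) (S n)) <= cell_cost * (g 1%nat - g (S n) + 2) + 1 + cot_max.
Proof.
intros HF Hg.
set (m := fun i => Int_part (g i)). set (f := fun i => frac_part (g i)).
assert (Eg : forall i, g i = IZR (m i) + f i) by (intros; unfold m, f, frac_part; ring).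
assert (Hf : forall i, 0 <= f i < 1) by (intros i; destruct (base_fp (g i)); unfold f; lra).
(* Summation by parts: the sum equals its boundary terms up to the drop of the potential. *)
assert (Inv : forall k, (k <= n)%nat ->
  Rabs (rsum (fun i => cos (F i)) k - (cos (F 1%nat) - cos (F (S k))) / 2
    - (cutcot (f 1%nat) * sin (F 1%nat) - cutcot (f (S k)) * sin (F (S k))) / 2)
  <= (IZR (m 1%nat) * cell_cost + pot (f 1%nat)) - (IZR (m (S k)) * cell_cost + pot (f (S k)))).
{ induction k as [|k IH]; intros Hk.
  - simpl rsum. match goal with |- Rabs ?e <= _ => replace e with 0 by field end.
    rewrite Rabs_R0. lra.
  - specialize (IH ltac:(lia)). rewrite rsum_S.
    assert (St := pot_step (m (S k)) (m (S (S k))) (f (S k)) (f (S (S k)))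
      (Hf _) (Hf _) ltac:(rewrite <- !Eg; apply Hg; lia)).
    assert (T := cos_telescope_step (F (S k)) (m (S k)) (f (S k)) (Hf _)).
    rewrite <- Eg, <- (HF (S k)) in T by lia.
    assert (B : Rabs ((cutcot (f (S (S k))) - cutcot (f (S k))) / 2 * sin (F (S (S k))))
      <= Rabs (cutcot (f (S k)) - cutcot (f (S (S k)))) / 2).
    { rewrite Rabs_mult, Rabs_div, (Rabs_right 2), Rabs_minus_sym by lra.
      pose proof (SIN_bound (F (S (S k)))).
      assert (Rabs (sin (F (S (S k)))) <= 1) by (apply Rabs_le; lra).
      pose proof (Rabs_pos (cutcot (f (S k)) - cutcot (f (S (S k))))). nra. }
    set (X := rsum _ k) in *.
    match type of IH with Rabs ?a <= _ => match type of T with Rabs ?b <= _ =>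
      match type of B with Rabs ?d <= _ =>
      match goal with |- Rabs ?e <= _ => replace e with (a + b + d) by field end end end end.
    eapply Rle_trans; [apply Rabs_triang|].
    eapply Rle_trans; [apply Rplus_le_compat_r, Rabs_triang|]. lra. }
specialize (Inv n (le_n n)). rewrite rsum_S.
set (X := rsum _ n) in *.
pose proof (pot_upper (f 1%nat) (Hf _)) as U1. pose proof (pot_lower (f (S n)) (Hf _)) as L2.
assert (Hcut : forall y, 0 <= y < 1 -> Rabs (cutcot y) <= cot_max).
{ intros y Hy. unfold cutcot. pose proof cot_max_pos.
  destruct (Rlt_dec y delta); [|destruct (Rlt_dec (1 - delta) y)]; try (rewrite Rabs_R0; lra).
  apply cot_le_cot_max. lra. }
assert (Hb : 0 <= pot (f (S n))).
{ unfold pot. pose proof cot_max_pos. destruct (Hf (S n)).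
  destruct (Rlt_dec (f (S n)) delta); [|destruct (Rlt_dec (1 - delta) (f (S n)))].
  - apply Rdiv_le_0_compat; lra.
  - assert (0 <= delta / lambda) by (apply Rdiv_le_0_compat; lra).
    assert (0 <= (f (S n) - (1 - delta)) / lambda) by (apply Rdiv_le_0_compat; lra). lra.
  - assert (0 <= delta / lambda) by (apply Rdiv_le_0_compat; lra).
    pose proof (cot_le_cot_max (f (S n)) ltac:(lra)) as Q. apply Rabs_le_between in Q. lra. }
assert (Ms : forall y z, 0 <= y < 1 -> Rabs (cutcot y * sin z) <= cot_max).
{ intros y z Hy. rewrite Rabs_mult. pose proof (Hcut y Hy). pose proof (SIN_bound z).
  assert (Rabs (sin z) <= 1) by (apply Rabs_le; lra).
  pose proof (Rabs_pos (cutcot y)). pose proof (Rabs_pos (sin z)). nra. }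
pose proof (Ms (f 1%nat) (F 1%nat) (Hf _)) as M1. pose proof (Ms (f (S n)) (F (S n)) (Hf _)) as M2.
pose proof (COS_bound (F 1%nat)) as C1. pose proof (COS_bound (F (S n))) as C2.
pose proof (Rabs_pos (cutcot (f 1%nat))) as P1.
(* One cell is lost in passing from integer parts to [g], and a second one in bounding [pot (f 1)];
   hence the 2 in the statement. *)
assert (G : (IZR (m 1%nat) - IZR (m (S n))) * cell_cost <= (g 1%nat - g (S n) + 1) * cell_cost).
{ apply Rmult_le_compat_r; [left; apply cell_cost_pos|]. rewrite !Eg.
  pose proof (Hf 1%nat). pose proof (Hf (S n)). lra. }
apply Rabs_le_between in Inv. apply Rabs_le_between in M1. apply Rabs_le_between in M2.
apply Rabs_le. lra.
Qed.

End KusminLandau.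

(** * Cosine sums over dyadic blocks *)

Lemma rsum_split f P k : rsum f (P + k) = rsum f P + rsum (fun i => f (P + i)%nat) k.
Proof.
induction k as [|k IH].
- rewrite Nat.add_0_r. simpl. ring.
- rewrite Nat.add_succ_r, !rsum_S, IH, Nat.add_succ_r. ring.
Qed.

(** With tails T(P) over [P < a <= B], the weighted sum is A T(A) plus the T(P) for [A <= P < B].
    Tails rather than initial sums keep the endpoint [B] fixed, as the parameters of
    [cos_block_bound] require. *)
Lemma abel_tail_bound (f : nat -> R) (A B : nat) (M : R) : (A <= B)%nat -> 0 <= M ->
  (forall P, (A <= P < B)%nat -> Rabs (rsum f B - rsum f P) <= M) ->
  Rabs (rsum (fun a => INR a * f a) B - rsum (fun a => INR a * f a) A) <= INR B * M.
Proof.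
intros HAB HM HT.
assert (HT' : forall P, (A <= P <= B)%nat -> Rabs (rsum f B - rsum f P) <= M).
{ intros P HP. destruct (Nat.eq_dec P B) as [->|]; [|apply HT; lia].
  now rewrite Rminus_diag, Rabs_R0. }
assert (K : forall k, (A + k <= B)%nat ->
  Rabs (rsum (fun a => INR a * f a) (A + k) - rsum (fun a => INR a * f a) A
        + INR (A + k) * (rsum f B - rsum f (A + k))) <= INR (A + k) * M).
{ induction k as [|k IH]; intros Hk.
  - rewrite Nat.add_0_r, Rminus_diag, Rplus_0_l, Rabs_mult, Rabs_right
      by (apply Rle_ge, pos_INR).
    apply Rmult_le_compat_l; [apply pos_INR | apply HT'; lia].
  - specialize (IH ltac:(lia)). specialize (HT' (A + k)%nat ltac:(lia)).
    rewrite Nat.add_succ_r, !rsum_S, S_INR.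
    set (Q := (A + k)%nat) in *.
    match type of IH with Rabs ?a <= _ => match type of HT' with Rabs ?b <= _ =>
      match goal with |- Rabs ?e <= _ => replace e with (a + b) by ring end end end.
    eapply Rle_trans; [apply Rabs_triang|]. lra. }
specialize (K (B - A)%nat ltac:(lia)). replace (A + (B - A))%nat with B in K by lia.
rewrite Rminus_diag, Rmult_0_r, Rplus_0_r in K. exact K.
Qed.

Definition phase (X : R) (a : nat) : R := 2 * PI * X / INR a.

(* Kusmin-Landau with [lambda = 2 X / B ^ 3] and [delta ^ 2 = lambda / PI], for which
   [delta / lambda = 1 / (PI * delta)]. *)
Lemma cos_block_bound (X w : R) (A B P : nat) :
  10000 <= X -> 0 < w -> w ^ 2 = INR B ^ 3 / X -> 19 <= w ->
  (1 <= A <= P)%nat -> (P < B <= 2 * A)%nat ->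
  Rabs (rsum (fun a => cos (phase X a)) B - rsum (fun a => cos (phase X a)) P)
  <= w * (27 / 5 * (X / INR B ^ 2) + 21 / 5).
Proof.
intros HX Hw Ew Hw19 HA HB.
assert (Pi : 3 < PI) by (pose proof PI2_3_2; unfold PI2 in *; lra).
assert (B1 : 0 < INR B) by (apply lt_0_INR; lia).
assert (B3 : INR B ^ 3 = w ^ 2 * X) by (rewrite Ew; field; lra).
(* [B^3 = w^2 X >= 361 * 10000], which exceeds [100^3]. *)
assert (B100 : 100 <= INR B).
{ destruct (Rlt_dec (INR B) 100) as [H|H]; [|lra]. exfalso.
  assert (INR B ^ 3 <= 100 ^ 3) by (apply pow_incr; lra).
  assert (361 * 10000 <= w ^ 2 * X) by (apply Rmult_le_compat; nra). nra. }
set (lam := 2 * X / INR B ^ 3).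
assert (Hlam : lam = 2 / w ^ 2) by (unfold lam; rewrite B3; field; lra).
assert (Plam : 0 < lam) by (rewrite Hlam; apply Rdiv_lt_0_compat; nra).
set (del := sqrt (lam / PI)).
assert (Pdel : 0 < del) by (apply sqrt_lt_R0, Rdiv_lt_0_compat; lra).
assert (Edel : del * del = lam / PI) by (apply sqrt_sqrt, Rlt_le, Rdiv_lt_0_compat; lra).
set (W := / (PI * del)).
assert (PW : 0 < W) by (apply Rinv_0_lt_compat; nra).
assert (EW : del / lam = W).
{ unfold W. replace lam with (PI * (del * del)) by (rewrite Edel; field; lra). field. lra. }
assert (W2 : W * W = w ^ 2 / (2 * PI)).
{ unfold W. replace (/ (PI * del) * / (PI * del)) with (/ (PI * PI * (del * del))) by (field; lra).
  rewrite Edel, Hlam. field. lra. }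
(* [W^2 = w^2 / (2 PI) <= w^2 / 6], and 41/100 exceeds the square root of 1/6. *)
assert (BW : W <= 41 / 100 * w).
{ assert (W * W <= 1 / 6 * w ^ 2).
  { rewrite W2. unfold Rdiv at 1. rewrite Rmult_comm. apply Rmult_le_compat_r; [nra|].
    replace (1 / 6) with (/ (2 * 3)) by field. apply Rinv_le_contravar; lra. }
  destruct (Rle_dec W (41 / 100 * w)); [assumption|]. exfalso.
  assert (41 / 100 * w * (41 / 100 * w) < W * W) by (apply Rmult_le_0_lt_compat; lra). nra. }
assert (D2 : del < 1 / 2).
{ destruct (Rlt_dec del (1 / 2)); [assumption|]. exfalso.
  assert (lam / PI <= 2 / 361 / 3).
  { apply Rmult_le_compat; try lra.
    - left; apply Rinv_0_lt_compat; lra.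
    - rewrite Hlam. apply Rmult_le_compat_l; [lra|]. apply Rinv_le_contravar; nra.
    - apply Rinv_le_contravar; lra. }
  nra. }
assert (Pos : forall i, (P + i >= 1)%nat -> 1 <= INR (P + i)).
{ intros i Hi. change 1 with (INR 1). apply le_INR. lia. }
(* The phase differences divided by 2 PI: [X / a - X / (a + 1)]. *)
set (g := fun i => X / (INR (P + i) * (INR (P + i) + 1))).
pose proof (kusmin_landau del lam ltac:(lra) Plam (fun i => phase X (P + i)) g (B - P - 1)) as K.
unfold cell_cost, cot_max in K. fold W in K.
replace (2 * del / lam) with (2 * W) in K by (rewrite <- EW; field; lra).
replace B with (P + S (B - P - 1))%nat at 1 by lia.
rewrite rsum_split, Rplus_minus_l. eapply Rle_trans; [apply K|].
- intros i Hi. unfold phase, g. rewrite Nat.add_succ_r, S_INR.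
  pose proof (Pos i ltac:(lia)). field. lra.
- intros i Hi. unfold g. rewrite Nat.add_succ_r, S_INR.
  pose proof (Pos i ltac:(lia)) as H1. set (a := INR (P + i)) in *.
  assert (a + 1 <= INR B) by (unfold a; rewrite <- S_INR; apply le_INR; lia).
  assert (lam <= 2 * X / (a * (a + 1) * (a + 2))).
  { unfold lam. apply Rmult_le_compat_l; [lra|]. apply Rinv_le_contravar.
    - repeat apply Rmult_lt_0_compat; lra.
    - apply Rle_trans with ((a + 1) ^ 3); [nra | apply pow_incr; lra]. }
  replace (X / ((a + 1) * (a + 1 + 1))) with (X / (a * (a + 1)) - 2 * X / (a * (a + 1) * (a + 2)))
    by (field; lra). lra.
(* The first value is at most [4 X / B^2] because [2 (P + 1) >= B]; the last is at least
   [99/100 * X / B^2] because [B >= 100]. *)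
- assert (G : g 1%nat - g (S (B - P - 1)) <= 301 / 100 * (X / INR B ^ 2)).
  { unfold g. replace (P + S (B - P - 1))%nat with B by lia.
    assert (HP : INR B <= 2 * INR (P + 1)).
    { replace 2 with (INR 2) by (simpl; lra). rewrite <- mult_INR. apply le_INR. lia. }
    assert (X / (INR (P + 1) * (INR (P + 1) + 1)) <= 4 * (X / INR B ^ 2)).
    { replace (4 * (X / INR B ^ 2)) with (X * / (INR B ^ 2 / 4)) by (field; lra).
      apply Rmult_le_compat_l; [lra|]. apply Rinv_le_contravar; nra. }
    assert (99 / 100 * (X / INR B ^ 2) <= X / (INR B * (INR B + 1))).
    { replace (99 / 100 * (X / INR B ^ 2)) with (X * / (INR B ^ 2 * (100 / 99))) by (field; lra).
      apply Rmult_le_compat_l; [lra|]. apply Rinv_le_contravar; nra. }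
    lra. }
  set (z := X / INR B ^ 2) in *.
  assert (0 < z) by (apply Rdiv_lt_0_compat; [lra | apply pow_lt; lra]).
  (* [4 * 41/100 + 2/19 < 7/4], where [2 <= 2 w / 19]. The constants 27/5 and 21/5 round up
     [7/4 * 301/100] and [7/2 + 1/19 + 41/100]. *)
  assert (H1 : 2 * W + 2 + 2 * W <= w * (7 / 4)) by lra.
  apply Rle_trans with ((w * (7 / 4)) * (301 / 100 * z + 2) + w / 19 + 41 / 100 * w); [|nra].
  assert ((2 * W + 2 + 2 * W) * (g 1%nat - g (S (B - P - 1)) + 2)
    <= (w * (7 / 4)) * (301 / 100 * z + 2)).
  { apply Rle_trans with ((2 * W + 2 + 2 * W) * (301 / 100 * z + 2)).
    - apply Rmult_le_compat_l; lra.
    - apply Rmult_le_compat_r; lra. }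
  lra.
Qed.

Definition cos_sum (X : R) (N : nat) : R := rsum (fun a => INR a * cos (phase X a)) N.

Lemma cos_sum_trivial X N : Rabs (cos_sum X N) <= INR N ^ 2.
Proof.
destruct N as [|N]; [unfold cos_sum; simpl; rewrite Rabs_R0; lra|].
apply Rle_trans with (rsum INR (S N)).
- apply rsum_abs_le. intros a Ha. rewrite Rabs_mult, Rabs_right by (apply Rle_ge, pos_INR).
  pose proof (COS_bound (phase X a)). pose proof (pos_INR a).
  assert (Rabs (cos (phase X a)) <= 1) by (apply Rabs_le; lra). nra.
- rewrite rsum_INR. assert (1 <= INR (S N)) by (change 1 with (INR 1); apply le_INR; lia). nra.
Qed.

(** Strong induction, halving [N]. If [b^3 <= 19 s], the trivial bound b^4 suffices; otherwise
    [w >= 19] and the block bound applies. The constants close the recursion: halving multiplies the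
    two terms by at most 711/1000 and 2/10, and [19 * 711/1000 + 27/5 <= 19],
    [6 * 2/10 + 21/5 <= 6]. *)
Lemma cos_sum_bound X N : 10000 <= X ->
  Rabs (cos_sum X N) <= 19 * (sqrt X * sqrt (INR N)) + 6 * (sqrt (INR N) ^ 5 / sqrt X).
Proof.
intros HX.
assert (PX : 0 < sqrt X) by (apply sqrt_lt_R0; lra).
assert (EX : sqrt X * sqrt X = X) by (apply sqrt_sqrt; lra).
induction N as [N IH] using (well_founded_induction lt_wf).
pose proof (sqrt_pos (INR N)) as P0.
assert (E0 : sqrt (INR N) * sqrt (INR N) = INR N) by apply sqrt_sqrt, pos_INR.
set (s := sqrt X) in *. set (b := sqrt (INR N)) in *.
assert (Q0 : 0 <= b ^ 5 / s) by (apply Rdiv_le_0_compat; [apply pow_le|]; lra).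
destruct (Rle_dec (b ^ 3) (19 * s)) as [Hsmall|Hbig].
- eapply Rle_trans; [apply cos_sum_trivial|]. rewrite <- E0.
  replace ((b * b) ^ 2) with (b ^ 3 * b) by ring. nra.
- set (A := ((N + 1) / 2)%nat).
  assert (b3 : 0 < b ^ 3) by lra.
  assert (Pb : 0 < b).
  { destruct (Rle_lt_or_eq_dec 0 b P0) as [H|H]; [exact H|]. rewrite <- H in b3. simpl in b3. lra. }
  assert (N100 : 100 <= INR N).
  { destruct (Rlt_dec (INR N) 100) as [H|H]; [|lra]. exfalso.
    assert (b ^ 3 <= 10 ^ 3) by (apply pow_incr; nra).
    assert (100 <= s) by (unfold s; replace 100 with (sqrt (100 * 100));
      [apply sqrt_le_1; lra | apply sqrt_square; lra]). lra. }
  assert (NA : (N <= 2 * A <= N + 1)%nat).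
  { unfold A. pose proof (Nat.div_mod_eq (N + 1) 2).
    pose proof (Nat.mod_upper_bound (N + 1) 2 ltac:(lia)). lia. }
  assert (N2 : (2 <= N)%nat).
  { apply INR_le. simpl. lra. }
  set (w := b ^ 3 / s).
  assert (Ew : w ^ 2 = INR N ^ 3 / X) by (unfold w; rewrite <- EX, <- E0; field; lra).
  assert (Hw : 19 <= w).
  { unfold w. apply Rmult_le_reg_r with s; trivial.
    replace (b ^ 3 / s * s) with (b ^ 3) by (field; lra). lra. }
  assert (Blk : Rabs (cos_sum X N - cos_sum X A)
    <= INR N * (w * (27 / 5 * (X / INR N ^ 2) + 21 / 5))).
  { apply abel_tail_bound; [lia | |].
    - apply Rmult_le_pos; [lra|].
      assert (0 <= X / INR N ^ 2) by (apply Rdiv_le_0_compat; [lra | apply pow_lt; lra]). lra.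
    - intros P HP. apply (cos_block_bound X w A); trivial; try lra; lia. }
  specialize (IH A ltac:(lia)).
  pose proof (sqrt_pos (INR A)) as Pa.
  assert (Ea : sqrt (INR A) * sqrt (INR A) = INR A) by apply sqrt_sqrt, pos_INR.
  set (a := sqrt (INR A)) in *.
  assert (A2 : 2 * INR A <= INR N + 1).
  { replace 2 with (INR 2) by (simpl; lra). rewrite <- mult_INR, <- S_INR. apply le_INR. lia. }
  assert (Hab : a <= 711 / 1000 * b).
  { destruct (Rle_dec a (711 / 1000 * b)); [assumption|]. exfalso.
    assert (711 / 1000 * b * (711 / 1000 * b) < a * a) by (apply Rmult_le_0_lt_compat; lra). nra. }
  assert (H5 : a ^ 5 / s <= 2 / 10 * (b ^ 5 / s)).
  { replace (2 / 10 * (b ^ 5 / s)) with ((2 / 10 * b ^ 5) / s) by (field; lra).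
    apply Rmult_le_compat_r; [left; now apply Rinv_0_lt_compat|].
    apply Rle_trans with ((711 / 1000 * b) ^ 5); [apply pow_incr; lra|].
    rewrite Rpow_mult_distr. apply Rmult_le_compat_r; [apply pow_le|]; lra. }
  assert (H1 : s * a <= 711 / 1000 * (s * b)) by nra.
  replace (INR N * (w * (27 / 5 * (X / INR N ^ 2) + 21 / 5)))
    with (27 / 5 * (s * b) + 21 / 5 * (b ^ 5 / s)) in Blk
    by (unfold w; rewrite <- EX, <- E0; field; lra).
  replace (cos_sum X N) with (cos_sum X A + (cos_sum X N - cos_sum X A)) by ring.
  eapply Rle_trans; [apply Rabs_triang|].
  assert (0 <= s * b) by nra. lra.
Qed.

(** * Finite Fourier expansion of the second Bernoulli polynomial *)

Lemma jordan_sin t : 0 <= t <= PI / 2 -> 2 / PI * t <= sin t.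
Proof.
intros Ht. pose proof PI_RGT_0 as HP.
destruct (Rle_dec (2 / PI * t) (sin t)) as [H|H]; [exact H|]. exfalso.
assert (t <> 0) by (intros ->; rewrite sin_0 in H; lra).
assert (t <> PI / 2).
{ intros ->. rewrite sin_PI2 in H. replace (2 / PI * (PI / 2)) with 1 in H by (field; lra). lra. }
(* The chord slopes on both sides of [t] contradict the monotonicity of [cos]. *)
assert (D : forall a b, a < b -> exists c, a <= c <= b /\ sin b - sin a = cos c * (b - a)).
{ intros a b Hab. destruct (MVT_gen sin a b cos) as [c [Hc E]].
  - intros s _. apply is_derive_Reals, derivable_pt_lim_sin.
  - intros s _. apply continuity_sin.
  - rewrite Rmin_left, Rmax_right in Hc by lra. now exists c. }
destruct (D 0 t ltac:(lra)) as [c1 [Hc1 E1]]. destruct (D t (PI / 2) ltac:(lra)) as [c2 [Hc2 E2]].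
rewrite sin_0 in E1. rewrite sin_PI2 in E2.
assert (cos c2 <= cos c1) by (apply cos_decr_1; lra).
assert (S1 : cos c1 < 2 / PI) by (apply Rmult_lt_reg_r with t; lra).
assert (S2 : 2 / PI < cos c2).
{ apply Rmult_lt_reg_r with (PI / 2 - t); [lra|]. rewrite <- E2.
  replace (2 / PI * (PI / 2 - t)) with (1 - 2 / PI * t) by (field; lra). lra. }
lra.
Qed.

Lemma cos_lipschitz a b : Rabs (cos a - cos b) <= Rabs (a - b).
Proof.
assert (K : forall a b, a <= b -> Rabs (cos a - cos b) <= b - a).
{ clear a b. intros a b Hab.
  assert (cos b - b <= cos a - a).
  { apply (nonincreasing_of_derive (fun s => cos s - s) (fun s => - sin s - 1)); trivial.
    - intros s _. auto_derive; [auto | ring].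
    - intros s _. pose proof (SIN_bound s). lra. }
  assert (cos a + a <= cos b + b).
  { apply (nondecreasing_of_derive (fun s => cos s + s) (fun s => - sin s + 1)); trivial.
    - intros s _. auto_derive; [auto | ring].
    - intros s _. pose proof (SIN_bound s). lra. }
  apply Rabs_le. lra. }
destruct (Rle_dec a b) as [H|H].
- rewrite (Rabs_minus_sym a b), (Rabs_right (b - a)) by lra. now apply K.
- rewrite (Rabs_minus_sym (cos a)), (Rabs_right (a - b)) by lra. apply K. lra.
Qed.

Lemma dirichlet_kernel t n :
  2 * sin t * rsum (fun k => cos (2 * INR k * t)) n = sin ((2 * INR n + 1) * t) - sin t.
Proof.
induction n as [|n IH].
- simpl. replace ((2 * 0 + 1) * t) with t by ring. ring.
- rewrite rsum_S, Rmult_plus_distr_l, IH, S_INR.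
  replace ((2 * (INR n + 1) + 1) * t) with (2 * (INR n + 1) * t + t) by ring.
  replace ((2 * INR n + 1) * t) with (2 * (INR n + 1) * t - t) by ring.
  rewrite sin_plus, sin_minus. ring.
Qed.

Lemma sin_INR_PI n : sin (INR n * PI) = 0.
Proof. apply sin_eq_0_1. exists (Z.of_nat n). now rewrite <- INR_IZR_INZ. Qed.

Lemma rsum_sqr n : rsum (fun j => INR j ^ 2) n = INR n * (INR n + 1) * (2 * INR n + 1) / 6.
Proof. induction n as [|n IH]; [simpl; field | rewrite rsum_S, IH, S_INR; field]. Qed.

(** The discrete Fourier coefficient of [bern2] sampled at the multiples of 1 / (2 K + 1). As [K]
    grows it tends to 1 / (PI k)^2, the coefficient of the Fourier series. *)
Definition fourier_coef (K k : nat) : R :=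
  / (INR (2 * K + 1) ^ 2 * sin (PI * INR k / INR (2 * K + 1)) ^ 2).

Lemma odd_INR K : INR (2 * K + 1) = 2 * INR K + 1.
Proof. rewrite plus_INR, mult_INR. simpl. ring. Qed.

Lemma sin_node_lower K k : (1 <= k <= K)%nat ->
  2 * INR k / INR (2 * K + 1) <= sin (PI * INR k / INR (2 * K + 1)).
Proof.
intros Hk. pose proof PI_RGT_0 as HP.
assert (INR k <= INR K) by (apply le_INR; lia). assert (0 < INR k) by (apply lt_0_INR; lia).
pose proof (odd_INR K) as EQ. set (Q := INR (2 * K + 1)) in *.
replace (2 * INR k / Q) with (2 / PI * (PI * INR k / Q)) by (field; lra).
apply jordan_sin. split.
- apply Rdiv_le_0_compat; nra.
- apply Rmult_le_reg_r with Q; [lra|].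
  replace (PI * INR k / Q * Q) with (PI * INR k) by (field; lra). nra.
Qed.

Lemma sin_node_pos K k : (1 <= k <= K)%nat -> 0 < sin (PI * INR k / INR (2 * K + 1)).
Proof.
intros Hk. eapply Rlt_le_trans; [|now apply sin_node_lower].
apply Rdiv_lt_0_compat; [|apply lt_0_INR; lia].
apply Rmult_lt_0_compat; [lra | apply lt_0_INR; lia].
Qed.

Lemma fourier_coef_bound K k : (1 <= k <= K)%nat -> 0 <= fourier_coef K k <= / (4 * INR k ^ 2).
Proof.
intros Hk. pose proof (sin_node_lower K k Hk) as L. pose proof (sin_node_pos K k Hk) as P.
unfold fourier_coef. assert (PQ : 0 < INR (2 * K + 1)) by (apply lt_0_INR; lia).
set (s := sin _) in *. set (Q := INR (2 * K + 1)) in *.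
assert (Pk : 0 < INR k) by (apply lt_0_INR; lia).
split; [left; apply Rinv_0_lt_compat; apply Rmult_lt_0_compat; nra|].
apply Rinv_le_contravar; [nra|].
rewrite <- Rpow_mult_distr. replace (4 * INR k ^ 2) with ((2 * INR k) ^ 2) by ring.
apply pow_incr. split; [lra|].
apply Rmult_le_compat_l with (r := Q) in L; [|lra].
replace (Q * (2 * INR k / Q)) with (2 * INR k) in L by (field; lra). lra.
Qed.

Definition dft (K j : nat) : R :=
  rsum (fun k => / sin (PI * INR k / INR (2 * K + 1)) ^ 2
                 * cos (2 * INR k * (PI * INR j / INR (2 * K + 1)))) K.

(** A second difference multiplies the term of frequency [k] by [-4 sin^2], which cancels its
    coefficient. The Dirichlet kernel that remains is -1/2 at a node. *)
Lemma dft_second_difference K j : (S j < 2 * K + 1)%nat ->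
  dft K (S (S j)) + dft K j - 2 * dft K (S j) = 2.
Proof.
intros Hj. pose proof PI_RGT_0 as HP.
assert (PQ : 0 < INR (2 * K + 1)) by (apply lt_0_INR; lia).
set (t := PI * INR (S j) / INR (2 * K + 1)).
assert (E : dft K (S (S j)) + dft K j - 2 * dft K (S j)
  = - 4 * rsum (fun k => cos (2 * INR k * t)) K).
{ unfold dft, Rminus. rewrite Ropp_mult_distr_l, <- !rsum_scal, <- !rsum_plus.
  apply rsum_ext. intros k Hk. pose proof (sin_node_pos K k Hk) as P.
  set (th := PI * INR k / INR (2 * K + 1)) in *.
  replace (2 * INR k * (PI * INR (S (S j)) / INR (2 * K + 1))) with (2 * INR k * t + 2 * th)
    by (unfold t, th; rewrite !S_INR; field; lra).
  replace (2 * INR k * (PI * INR j / INR (2 * K + 1))) with (2 * INR k * t - 2 * th)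
    by (unfold t, th; rewrite !S_INR; field; lra).
  fold t. rewrite cos_plus, cos_minus, (cos_2a_sin th). field. lra. }
rewrite E. pose proof (dirichlet_kernel t K) as D. rewrite <- odd_INR in D.
replace (INR (2 * K + 1) * t) with (INR (S j) * PI) in D by (unfold t; field; lra).
rewrite sin_INR_PI in D.
assert (0 < sin t).
{ assert (INR (S j) < INR (2 * K + 1)) by now apply lt_INR.
  assert (0 < INR (S j)) by (apply lt_0_INR; lia). unfold t. apply sin_gt_0.
  - apply Rdiv_lt_0_compat; nra.
  - apply Rmult_lt_reg_r with (INR (2 * K + 1)); trivial.
    replace (PI * INR (S j) / INR (2 * K + 1) * INR (2 * K + 1)) with (PI * INR (S j))
      by (field; lra). nra. }
set (X := rsum _ K) in *. nra.
Qed.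

Lemma quadratic_of_second_difference (G : nat -> R) q :
  (forall j, (S j < q)%nat -> G (S (S j)) + G j - 2 * G (S j) = 2) ->
  forall j, (j <= q)%nat -> G j = G 0%nat + INR j * (G 1%nat - G 0%nat) + INR j * (INR j - 1).
Proof.
intros H j. induction j as [j IH] using (well_founded_induction lt_wf). intros Hj.
destruct j as [|[|j]]; [simpl; ring | simpl; ring|].
pose proof (H j ltac:(lia)) as E. rewrite (IH j), (IH (S j)) in E by lia.
rewrite !S_INR in *. lra.
Qed.

(** Each frequency [1 <= k <= K] sums to 0 over a full period, because the sine of its node is
    nonzero. *)
Lemma dft_sum_zero K : rsum (dft K) (2 * K + 1) = 0.
Proof.
unfold dft.
rewrite (rsum_swap (fun j k => / sin (PI * INR k / INR (2 * K + 1)) ^ 2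
                 * cos (2 * INR k * (PI * INR j / INR (2 * K + 1))))).
rewrite (rsum_ext _ (fun _ => 0)); [rewrite rsum_const; ring|].
intros k Hk. rewrite rsum_scal. pose proof (sin_node_pos K k Hk) as P.
assert (PQ : 0 < INR (2 * K + 1)) by (apply lt_0_INR; lia).
pose proof (dirichlet_kernel (PI * INR k / INR (2 * K + 1)) (2 * K + 1)) as D.
set (th := PI * INR k / INR (2 * K + 1)) in *.
rewrite (rsum_ext _ (fun j => cos (2 * INR j * th))).
2:{ intros j _. f_equal. unfold th. field. lra. }
replace ((2 * INR (2 * K + 1) + 1) * th) with (th + 2 * INR k * PI) in D by (unfold th; field; lra).
rewrite sin_period, Rminus_diag in D.
destruct (Rmult_integral _ _ D) as [Z|Z]; [lra | rewrite Z; ring].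
Qed.

(** Second difference 2 leaves two free constants: periodicity fixes the slope and the zero mean
    fixes the value at 0. *)
Lemma dft_value K j : (j <= 2 * K + 1)%nat ->
  dft K j = INR j ^ 2 - INR (2 * K + 1) * INR j + (INR (2 * K + 1) ^ 2 - 1) / 6.
Proof.
assert (PQ : 1 <= INR (2 * K + 1)) by (change 1 with (INR 1); apply le_INR; lia).
pose proof (quadratic_of_second_difference (dft K) (2 * K + 1) (dft_second_difference K)) as Qd.
assert (Per : dft K (2 * K + 1) = dft K 0).
{ unfold dft. apply rsum_ext. intros k _. f_equal.
  replace (2 * INR k * (PI * INR 0 / INR (2 * K + 1))) with 0 by (change (INR 0) with 0; field; lra).
  replace (2 * INR k * (PI * INR (2 * K + 1) / INR (2 * K + 1))) with (0 + 2 * INR k * PI)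
    by (field; lra).
  apply cos_period. }
pose proof (Qd (2 * K + 1)%nat (le_n _)) as E1. rewrite Per in E1.
pose proof (dft_sum_zero K) as S0.
set (Q := INR (2 * K + 1)) in *.
assert (Sl : dft K 1 - dft K 0 = 1 - Q).
{ apply Rmult_eq_reg_l with Q; [|lra]. lra. }
rewrite (rsum_ext _ (fun j => dft K 0 + ((- Q) * INR j + INR j ^ 2))) in S0.
2:{ intros i Hi. rewrite (Qd i) by lia. rewrite Sl. ring. }
rewrite !rsum_plus, rsum_const, rsum_scal, rsum_INR, rsum_sqr in S0. fold Q in S0.
assert (G0 : dft K 0 = (Q ^ 2 - 1) / 6).
{ apply Rmult_eq_reg_l with Q; [|lra]. lra. }
intros Hj. rewrite (Qd j Hj), Sl, G0. ring.
Qed.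

(** The constant [1 / (6 Q^2)], with [Q = 2 K + 1], is the mean of [bern2] over the nodes; only its
    integral mean is 0. *)
Lemma bern2_node K j : (j <= 2 * K + 1)%nat ->
  bern2 (INR j / INR (2 * K + 1)) = / (6 * INR (2 * K + 1) ^ 2)
    + rsum (fun k => fourier_coef K k * cos (2 * PI * INR k * (INR j / INR (2 * K + 1)))) K.
Proof.
intros Hj. pose proof (dft_value K j Hj) as E.
assert (PQ : 0 < INR (2 * K + 1)) by (apply lt_0_INR; lia).
rewrite (rsum_ext _ (fun k => / INR (2 * K + 1) ^ 2 * (/ sin (PI * INR k / INR (2 * K + 1)) ^ 2
                 * cos (2 * INR k * (PI * INR j / INR (2 * K + 1)))))).
- rewrite rsum_scal. fold (dft K j). rewrite E. unfold bern2. field. lra.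
- intros k Hk. unfold fourier_coef. rewrite Rinv_mult, Rmult_assoc. do 3 f_equal. field. lra.
Qed.

Lemma harm_le_sqrt n : harm n <= 2 * sqrt (INR n).
Proof.
induction n as [|n IH]; [unfold harm; simpl; rewrite sqrt_0; lra|].
unfold harm in *. rewrite rsum_S.
assert (P : 1 <= INR (S n)) by (change 1 with (INR 1); apply le_INR; lia).
pose proof (pos_INR n) as Pn.
pose proof (sqrt_sqrt _ Pn) as En. pose proof (sqrt_sqrt (INR (S n)) ltac:(lra)) as Es.
pose proof (sqrt_pos (INR n)).
assert (1 <= sqrt (INR (S n))) by (rewrite <- sqrt_1; apply sqrt_le_1; lra).
assert (Hs : sqrt (INR n) <= sqrt (INR (S n))) by (apply sqrt_le_1; rewrite ?S_INR; lra).
rewrite S_INR in Es at 3.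
set (p := sqrt (INR n)) in *. set (r := sqrt (INR (S n))) in *.
assert (/ INR (S n) <= / r) by (apply Rinv_le_contravar; [lra|]; rewrite S_INR; nra).
assert (/ r <= 2 * (r - p)); [|lra].
apply Rmult_le_reg_r with r; [lra|]. rewrite Rinv_l by lra. nra.
Qed.

(** Moving [v] down to a node costs less than [1 / Q] in the argument. There [bern2] has Lipschitz
    constant 1, while the cosine polynomial changes by at most [2 / Q * harm K]; the crude bound
    [harm_le_sqrt] suffices, since [K] can be taken large. *)
Lemma bern2_fourier_approx K v y (m : nat) : (1 <= K)%nat -> 0 <= v <= 1 -> y = v + INR m ->
  Rabs (bern2 v - rsum (fun k => fourier_coef K k * cos (2 * PI * INR k * y)) K)
  <= 3 / sqrt (INR K).
Proof.
intros HK Hv ->. pose proof PI_RGT_0 as HP. pose proof PI_4 as HP4.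
assert (K1 : 1 <= INR K) by (change 1 with (INR 1); apply le_INR; lia).
pose proof (odd_INR K) as EQ.
pose proof (archimed (INR (2 * K + 1) * v)) as Ar.
set (jz := (up (INR (2 * K + 1) * v) - 1)%Z).
assert (Hjz : IZR jz <= INR (2 * K + 1) * v < IZR jz + 1) by (unfold jz; rewrite minus_IZR; lra).
clear Ar. assert (Jpos : (0 <= jz)%Z).
{ assert (-1 < jz)%Z by (apply lt_IZR; nra). lia. }
set (j := Z.to_nat jz).
assert (Hj : INR j <= INR (2 * K + 1) * v < INR j + 1)
  by (unfold j; rewrite INR_IZR_INZ, Z2Nat.id; assumption).
assert (jq : (j <= 2 * K + 1)%nat) by (apply INR_le; nra).
pose proof (bern2_node K j jq) as N. set (Q := INR (2 * K + 1)) in *.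
set (nd := INR j / Q) in *.
assert (Hnd : nd <= v < nd + / Q).
{ unfold nd. split.
  - apply Rmult_le_reg_r with Q; [lra|]. replace (INR j / Q * Q) with (INR j) by (field; lra). lra.
  - apply Rmult_lt_reg_r with Q; [lra|].
    replace ((INR j / Q + / Q) * Q) with (INR j + 1) by (field; lra). lra. }
assert (nd0 : 0 <= nd) by (apply Rdiv_le_0_compat; [apply pos_INR | lra]).
assert (PiQ : 0 < / Q) by (apply Rinv_0_lt_compat; lra).
assert (B : Rabs (bern2 v - bern2 nd) <= / Q).
{ unfold bern2. replace (_ - _) with ((v - nd) * (v + nd - 1)) by ring.
  rewrite Rabs_mult. rewrite <- (Rmult_1_r (/ Q)).
  apply Rmult_le_compat; try apply Rabs_pos; apply Rabs_le; lra. }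
assert (C : Rabs (rsum (fun k => fourier_coef K k * cos (2 * PI * INR k * (v + INR m))) K
  - rsum (fun k => fourier_coef K k * cos (2 * PI * INR k * nd)) K) <= 2 / Q * harm K).
{ unfold harm. rewrite <- rsum_scal.
  replace (_ - _) with (rsum (fun k => fourier_coef K k * cos (2 * PI * INR k * (v + INR m))
    + (-1) * (fourier_coef K k * cos (2 * PI * INR k * nd))) K)
    by (rewrite rsum_plus, rsum_scal; ring).
  apply rsum_abs_le. intros k Hk. pose proof (fourier_coef_bound K k Hk) as [F0 F1].
  assert (Pk : 0 < INR k) by (apply lt_0_INR; lia).
  replace (2 * PI * INR k * (v + INR m)) with (2 * PI * INR k * v + 2 * INR (k * m) * PI)
    by (rewrite mult_INR; ring).
  rewrite cos_period.
  pose proof (cos_lipschitz (2 * PI * INR k * v) (2 * PI * INR k * nd)) as L.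
  set (x := cos (2 * PI * INR k * v)) in *. set (z := cos (2 * PI * INR k * nd)) in *.
  replace (_ + _) with (fourier_coef K k * (x - z)) by ring.
  rewrite Rabs_mult, (Rabs_right (fourier_coef K k)) by lra.
  (* The 8 bounds 2 PI by way of [PI <= 4]. *)
  replace (2 / Q * / INR k) with (/ (4 * INR k ^ 2) * (8 * INR k * / Q)) by (field; lra).
  apply Rmult_le_compat; [lra | apply Rabs_pos | exact F1|].
  eapply Rle_trans; [exact L|].
  rewrite <- Rmult_minus_distr_l, Rabs_mult, !Rabs_right by nra.
  apply Rmult_le_compat; nra. }
set (P := rsum (fun k => fourier_coef K k * cos (2 * PI * INR k * (v + INR m))) K) in *.
set (P' := rsum (fun k => fourier_coef K k * cos (2 * PI * INR k * nd)) K) in *.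
replace (bern2 v - P) with ((bern2 v - bern2 nd) + (/ (6 * Q ^ 2) - (P - P'))) by (rewrite N; ring).
eapply Rle_trans; [apply Rabs_triang|]. unfold Rminus at 2.
eapply Rle_trans; [apply Rplus_le_compat_l, Rabs_triang|]. rewrite Rabs_Ropp.
assert (I6 : / (6 * Q ^ 2) <= / Q) by (apply Rinv_le_contravar; nra).
assert (I0 : 0 < / (6 * Q ^ 2)) by (apply Rinv_0_lt_compat; nra).
rewrite (Rabs_right (/ _)) by lra.
pose proof (harm_le_sqrt K) as HS.
assert (Es : sqrt (INR K) * sqrt (INR K) = INR K) by (apply sqrt_sqrt; lra).
assert (1 <= sqrt (INR K)) by (rewrite <- sqrt_1; apply sqrt_le_1; lra).
set (s := sqrt (INR K)) in *.
apply Rle_trans with (2 * / Q + 2 / Q * (2 * s)).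
- assert (2 / Q * harm K <= 2 / Q * (2 * s)) by (apply Rmult_le_compat_l; [|exact HS];
    apply Rdiv_le_0_compat; lra). lra.
- replace (2 * / Q + 2 / Q * (2 * s)) with ((2 + 4 * s) / Q) by (field; lra).
  apply Rmult_le_reg_r with (Q * s); [nra|].
  replace ((2 + 4 * s) / Q * (Q * s)) with ((2 + 4 * s) * s) by (field; lra).
  replace (3 / s * (Q * s)) with (3 * Q) by (field; lra). rewrite EQ. nra.
Qed.

(** * The two estimates *)

(** The terms are k^(-3/2), compared with the telescoping differences of [- 2 / sqrt k]. *)
Lemma rsum_sqrt_div_sqr n : rsum (fun k => sqrt (INR k) / INR k ^ 2) n <= 3.
Proof.
assert (H : rsum (fun k => sqrt (INR k) / INR k ^ 2) (S n) <= 3 - 2 / sqrt (INR (S n))).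
{ induction n as [|n IH].
  - simpl. rewrite sqrt_1. lra.
  - rewrite rsum_S.
    assert (P : 1 <= INR (S n)) by (change 1 with (INR 1); apply le_INR; lia).
    assert (E2 : INR (S (S n)) = INR (S n) + 1) by apply S_INR.
    pose proof (sqrt_sqrt (INR (S n)) ltac:(lra)) as Ep.
    pose proof (sqrt_sqrt (INR (S (S n))) ltac:(lra)) as Er.
    assert (1 <= sqrt (INR (S n))) by (rewrite <- sqrt_1; apply sqrt_le_1; lra).
    assert (Hs : sqrt (INR (S n)) <= sqrt (INR (S (S n)))) by (apply sqrt_le_1; lra).
    set (p := sqrt (INR (S n))) in *. set (r := sqrt (INR (S (S n)))) in *.
    assert (r / INR (S (S n)) ^ 2 <= 2 / p - 2 / r); [|lra].
    replace (r / INR (S (S n)) ^ 2) with (/ (r * r * r)) by (rewrite <- Er; field; lra).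
    assert (D : 1 = (r - p) * (r + p)) by lra.
    replace (2 / p - 2 / r) with (2 * (r - p) / (p * r)) by (field; lra).
    apply Rmult_le_reg_r with (r * r * r * p); [repeat apply Rmult_lt_0_compat; lra|].
    replace (/ (r * r * r) * (r * r * r * p)) with p by (field; lra).
    replace (2 * (r - p) / (p * r) * (r * r * r * p)) with (2 * (r - p) * (r * r)) by (field; lra).
    apply Rle_trans with (r * (r - p) * (r + p)); [nra|].
    replace (2 * (r - p) * (r * r)) with (r * (r - p) * (r + r)) by ring.
    apply Rmult_le_compat_l; nra. }
destruct n as [|n]; [simpl; lra|].
assert (0 < sqrt (INR (S (S n)))) by (apply sqrt_lt_R0, lt_0_INR; lia).
assert (0 <= 2 / sqrt (INR (S (S n)))) by (apply Rdiv_le_0_compat; lra).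
rewrite (rsum_S _ (S n)) in H.
assert (0 <= sqrt (INR (S (S n))) / INR (S (S n)) ^ 2).
{ apply Rdiv_le_0_compat; [lra | apply pow_lt, lt_0_INR; lia]. }
lra.
Qed.

(** For [N <= sqrt x] both quantities in [cos_sum_bound] are at most [sqrt k * x^(3/4)], and
    [25 = 19 + 6]. *)
Lemma cos_sum_multiple_bound x k : 10000 <= x -> (1 <= k)%nat ->
  Rabs (cos_sum (INR k * x) (rfloor (sqrt x)))
  <= 25 * sqrt (INR k) * (sqrt x * sqrt (sqrt x)).
Proof.
intros Hx Hk.
assert (K1 : 1 <= INR k) by (change 1 with (INR 1); apply le_INR; lia).
eapply Rle_trans; [apply cos_sum_bound; nra|].
rewrite sqrt_mult by lra.
assert (Hu : 1 <= sqrt x) by (rewrite <- sqrt_1; apply sqrt_le_1; lra).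
assert (Hk1 : 1 <= sqrt (INR k)) by (rewrite <- sqrt_1; apply sqrt_le_1; lra).
pose proof (rfloor_spec (sqrt x) ltac:(lra)) as HN.
set (u := sqrt x) in *. set (N := INR (rfloor u)) in *.
assert (P0 : 0 <= N) by apply pos_INR.
assert (Hn : sqrt N <= sqrt u) by (apply sqrt_le_1; lra).
pose proof (sqrt_pos N) as P1. assert (Eu : sqrt u * sqrt u = u) by (apply sqrt_sqrt; lra).
set (n := sqrt N) in *. set (s := sqrt (INR k)) in *. set (b := sqrt u) in *.
assert (b1 : 1 <= b) by (unfold b; rewrite <- sqrt_1; apply sqrt_le_1; lra).
assert (T1 : s * u * n <= s * (u * b)).
{ rewrite Rmult_assoc. apply Rmult_le_compat_l; [lra|]. apply Rmult_le_compat_l; lra. }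
assert (T2 : n ^ 5 / (s * u) <= s * (u * b)).
{ apply Rmult_le_reg_r with (s * u); [nra|].
  replace (n ^ 5 / (s * u) * (s * u)) with (n ^ 5) by (field; lra).
  apply Rle_trans with (b ^ 5); [apply pow_incr; lra|].
  replace (b ^ 5) with (1 * (u * b * u)) by (rewrite <- Eu; ring).
  replace (s * (u * b) * (s * u)) with (s * s * (u * b * u)) by ring.
  apply Rmult_le_compat_r; [repeat apply Rmult_le_pos; lra | nra]. }
lra.
Qed.

(** [75/4] is [25 * 1/4 * 3]: the cosine sums, the coefficients, and the sum of k^(-3/2). The
    approximation error occurs at most [sqrt x] times with weight at most [sqrt x]. *)
Lemma bern2_sum_fourier x K : 10000 <= x -> (1 <= K)%nat ->
  Rabs (bern2_sum x (rfloor (sqrt x)))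
  <= 75 / 4 * (sqrt x * sqrt (sqrt x)) + 3 / sqrt (INR K) * x.
Proof.
intros Hx HK. set (N := rfloor (sqrt x)).
assert (Hu : 1 <= sqrt x) by (rewrite <- sqrt_1; apply sqrt_le_1; lra).
assert (Ex : sqrt x * sqrt x = x) by (apply sqrt_sqrt; lra).
assert (K0 : 0 < sqrt (INR K)) by (apply sqrt_lt_R0, lt_0_INR; lia).
pose proof (rfloor_spec (sqrt x) ltac:(lra)) as HN. fold N in HN.
assert (PN : 0 <= INR N) by apply pos_INR.
set (p := fun a => rsum (fun k => fourier_coef K k * cos (2 * PI * INR k * (x / INR a))) K).
assert (H1 : Rabs (bern2_sum x N - rsum (fun a => INR a * p a) N) <= 3 / sqrt (INR K) * x).
{ unfold bern2_sum.
  replace (_ - _) with (rsum (fun a => INR a * bern2 (x / INR a - INR (rfloor x / a))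
    + (-1) * (INR a * p a)) N) by (rewrite rsum_plus, rsum_scal; ring).
  apply Rle_trans with (rsum (fun _ => sqrt x * (3 / sqrt (INR K))) N).
  - apply rsum_abs_le. intros a Ha.
    destruct (quotient_spec x a ltac:(lra) Ha) as (Pa & Q1 & Q2).
    replace (_ + _) with (INR a * (bern2 (x / INR a - INR (rfloor x / a)) - p a)) by ring.
    rewrite Rabs_mult, Rabs_right by lra.
    assert (INR a <= INR N) by (apply le_INR; lia).
    apply Rmult_le_compat; [lra | apply Rabs_pos | lra|].
    apply (bern2_fourier_approx K _ _ (rfloor x / a)); [exact HK | lra | ring].
  - rewrite rsum_const.
    assert (0 <= 3 / sqrt (INR K)) by (apply Rdiv_le_0_compat; lra).
    replace (3 / sqrt (INR K) * x) with (sqrt x * (sqrt x * (3 / sqrt (INR K))))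
      by (rewrite <- Ex at 3; ring).
    apply Rmult_le_compat_r; [nra | lra]. }
assert (H2 : rsum (fun a => INR a * p a) N
  = rsum (fun k => fourier_coef K k * cos_sum (INR k * x) N) K).
{ unfold p, cos_sum.
  rewrite (rsum_ext _ (fun a => rsum (fun k =>
    INR a * (fourier_coef K k * cos (2 * PI * INR k * (x / INR a)))) K))
    by (intros; now rewrite rsum_scal).
  rewrite (rsum_swap (fun a k => INR a * (fourier_coef K k * cos (2 * PI * INR k * (x / INR a))))).
  apply rsum_ext. intros k _. rewrite <- rsum_scal. apply rsum_ext. intros a Ha.
  unfold phase.
  replace (2 * PI * (INR k * x) / INR a) with (2 * PI * INR k * (x / INR a))
    by (unfold Rdiv; ring). ring. }
set (ub := sqrt x * sqrt (sqrt x)).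
assert (Pub : 0 <= ub) by (apply Rmult_le_pos; apply sqrt_pos).
assert (H3 : Rabs (rsum (fun k => fourier_coef K k * cos_sum (INR k * x) N) K) <= 75 / 4 * ub).
{ apply Rle_trans with (rsum (fun k => 25 / 4 * ub * (sqrt (INR k) / INR k ^ 2)) K).
  - apply rsum_abs_le. intros k Hk. pose proof (fourier_coef_bound K k Hk) as [F0 F1].
    rewrite Rabs_mult, (Rabs_right (fourier_coef K k)) by lra.
    assert (Pk : 0 < INR k) by (apply lt_0_INR; lia).
    replace (25 / 4 * ub * (sqrt (INR k) / INR k ^ 2))
      with (/ (4 * INR k ^ 2) * (25 * sqrt (INR k) * ub)) by (field; lra).
    apply Rmult_le_compat; [lra | apply Rabs_pos | exact F1|].
    apply cos_sum_multiple_bound; [lra | lia].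
  - rewrite rsum_scal. pose proof (rsum_sqrt_div_sqr K). nra. }
rewrite H2 in H1. set (S1 := rsum _ K) in *.
replace (bern2_sum x N) with (S1 + (bern2_sum x N - S1)) by ring.
eapply Rle_trans; [apply Rabs_triang|]. lra.
Qed.

Lemma bern2_sum_bound x : 10000 <= x ->
  Rabs (bern2_sum x (rfloor (sqrt x))) <= 19 * (sqrt x * sqrt (sqrt x)).
Proof.
intros Hx.
assert (Hu : 1 <= sqrt x) by (rewrite <- sqrt_1; apply sqrt_le_1; lra).
assert (Ex : sqrt x * sqrt x = x) by (apply sqrt_sqrt; lra).
assert (Hb : 1 <= sqrt (sqrt x)) by (rewrite <- sqrt_1 at 1; apply sqrt_le_1; lra).
assert (Eb : sqrt (sqrt x) * sqrt (sqrt x) = sqrt x) by (apply sqrt_sqrt; lra).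
(* This makes [sqrt K >= 12 b], so the approximation error is at most [1/4 * u * b], completing 75/4
   to 19. *)
set (K := S (rfloor (144 * sqrt x))).
pose proof (rfloor_spec (144 * sqrt x) ltac:(lra)) as HK.
eapply Rle_trans; [apply (bern2_sum_fourier x K Hx); unfold K; lia|].
assert (SK : 12 * sqrt (sqrt x) <= sqrt (INR K)).
{ rewrite <- (sqrt_square (12 * sqrt (sqrt x))) by lra. apply sqrt_le_1.
  - nra.
  - apply pos_INR.
  - unfold K. rewrite S_INR. lra. }
set (u := sqrt x) in *. set (b := sqrt u) in *.
assert (3 / sqrt (INR K) * x <= 1 / 4 * (u * b)); [|lra].
apply Rle_trans with (3 / (12 * b) * x).
- apply Rmult_le_compat_r; [lra|]. apply Rmult_le_compat_l; [lra|].
  apply Rinv_le_contravar; lra.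
- right. rewrite <- Ex, <- Eb. field. lra.
Qed.

(** The first diagonal Padé approximant of [ln] at 1; the difference has derivative
    [(t - 1)^2 / (t (t + 1)^2)]. *)
Lemma ln_lower y : 1 <= y -> 2 * (y - 1) / (y + 1) <= ln y.
Proof.
intros Hy.
assert (H : ln 1 - 2 * (1 - 1) / (1 + 1) <= ln y - 2 * (y - 1) / (y + 1)).
{ apply (nondecreasing_of_derive (fun t => ln t - 2 * (t - 1) / (t + 1))
    (fun t => (t - 1) ^ 2 / (t * (t + 1) ^ 2))); [exact Hy| |].
  - intros t Ht. auto_derive; [lra|]. field. lra.
  - intros t Ht. apply Rdiv_le_0_compat; [apply pow2_ge_0|].
    apply Rmult_lt_0_compat; [lra | apply pow_lt; lra]. }
rewrite ln_1 in H. lra.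
Qed.

(** At [9/7] the bound of [ln_lower] is exactly 1/4, and [20 / 4 = 5]. *)
Lemma ln_threshold : 5 <= ln ((9 / 7) ^ 20).
Proof.
rewrite ln_pow by lra. pose proof (ln_lower (9 / 7) ltac:(lra)).
replace (INR 20) with 20 by (simpl; lra). lra.
Qed.

Theorem theorem1p1 :
  exists r : R -> R,
    (forall x : R, 1 <= x -> Delta_tau x - x * delta_tau x = 1 / 4 + r x) /\
    (forall x : R, 1 <= x ->
       Rabs (r x) <= 1 / 8 + 0.316 / sqrt x + 1 / (64 * x)) /\
    (forall x : R, 300 <= x ->
       Rabs (r x) <= ln x / Rpower x (1 / 4) + 0.236 / sqrt x + 1 / (64 * x)).
Proof.
exists remainder. split; [exact Delta_delta_remainder | split; intros x Hx].
- pose proof (remainder_bound x Hx).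
  assert (0 < / sqrt x) by (apply Rinv_0_lt_compat, sqrt_lt_R0; lra).
  unfold Rdiv in *. lra.
- assert (Ex : sqrt x * sqrt x = x) by (apply sqrt_sqrt; lra).
  assert (Hu : 17 <= sqrt x).
  { replace 17 with (sqrt (17 * 17)) by (apply sqrt_square; lra). apply sqrt_le_1; lra. }
  assert (Eb : sqrt (sqrt x) * sqrt (sqrt x) = sqrt x) by (apply sqrt_sqrt; lra).
  assert (Hb : 3 <= sqrt (sqrt x)).
  { rewrite <- (sqrt_square 3) by lra. apply sqrt_le_1; lra. }
  assert (Er : Rpower x (1 / 4) = sqrt (sqrt x)).
  { replace (1 / 4) with (/ 2 * / 2) by field.
    rewrite <- Rpower_mult, (Rpower_sqrt x), Rpower_sqrt by lra. reflexivity. }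
  assert (El : ln x = 4 * ln (sqrt (sqrt x))).
  { assert (D : forall y, 0 < y -> ln (y * y) = 2 * ln y)
      by (intros y Hy; rewrite ln_mult by assumption; ring).
    pose proof (D (sqrt x) ltac:(lra)) as D1. pose proof (D (sqrt (sqrt x)) ltac:(lra)) as D2.
    rewrite Ex in D1. rewrite Eb in D2. lra. }
  rewrite Er, El.
  pose proof (remainder_bound x ltac:(lra)) as R1.
  pose proof (remainder_bern2_sum x ltac:(lra)) as R2.
  set (u := sqrt x) in *. set (b := sqrt u) in *.
  assert (Iu : 0 < / u) by (apply Rinv_0_lt_compat; lra).
  assert (Iu17 : / u <= / 17) by (apply Rinv_le_contravar; lra).
  pose proof ln_threshold as L5. set (t := (9 / 7) ^ 20) in *.
  assert (T : 3 <= t <= 153) by (unfold t; lra).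
  destruct (Rle_dec b t) as [H|H].
  (* The first estimate suffices here: [4 * 5 / 153] exceeds [1/8 + (11/36 - 0.236) / 17]. *)
  + pose proof (ln_div_nonincreasing b t ltac:(lra)) as M.
    assert (5 / 153 <= ln t / t).
    { apply Rmult_le_compat; try lra. apply Rinv_le_contravar; lra. }
    replace (4 * ln b / b) with (4 * (ln b / b)) by (field; lra).
    unfold Rdiv in *. lra.
  + assert (5 <= ln b) by (eapply Rle_trans; [exact L5 | apply ln_le; lra]).
    assert (Hx4 : 10000 <= x).
    { assert (152 <= t) by (unfold t; lra). rewrite <- Ex, <- Eb. nra. }
    pose proof (bern2_sum_bound x Hx4) as Bs. fold u b in Bs.
    set (s := Rabs (bern2_sum _ _)) in *.
    assert (s / x <= 19 / b).
    { replace (19 / b) with (19 * (u * b) / x) by (rewrite <- Ex, <- Eb; field; lra).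
      apply Rmult_le_compat_r; [left; apply Rinv_0_lt_compat; lra | exact Bs]. }
    (* Of these 20 units 19 pay for the Bernoulli sum; the last covers the excess of 1/4 over 0.236,
       since [/ u <= / b]. *)
    assert (20 / b <= 4 * ln b / b).
    { apply Rmult_le_compat_r; [left; apply Rinv_0_lt_compat|]; lra. }
    assert (/ u <= / b) by (apply Rinv_le_contravar; nra).
    unfold Rdiv in *. lra.
Qed.
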